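(* Let $m$ be a positive integer with $m\neq 3$ such that the odd part of $m^2+16$ is squarefree (i.e. $m^2+16$ is not divisible by the square of any odd prime). Let $P_m(x)=x^4-mx^3-6x^2+mx+1$, let $\theta$ be a root of $P_m$, and let $\mathbb{K}_m=\mathbb{Q}(\theta)$ with ring of integers $\mathbb{O}_{\mathbb{K}_m}$. Then: \begin{enumerate} \item $I(\mathbb{K}_m)=2$ if $m$ is odd, and $I(\mathbb{K}_m)=1$ if $m$ is even. \item If $m$ is odd (index $2$), the prime ideal factorization of $2$ is $$2\mathbb{O}_{\mathbb{K}_m}=\left\langle 2,\tfrac{1+\sqrt{m^2+16}}{2}\right\rangle\left\langle 2,\tfrac{1-\sqrt{m^2+16}}{2}\right\rangle.$$ \item If $m$ is even (index $1$), the prime ideal factorization of $2$ is as follows, where $v_2$ denotes the $2$-adic valuation: \begin{enumerate} \item if $v_2(m)=1$: $2\mathbb{O}_{\mathbb{K}_m}=\left\langle 2,\frac{m\theta^3+10\theta^2-m\theta+6}{4}\right\rangle^2$; \item if $v_2(m)=2$: $2\mathbb{O}_{\mathbb{K}_m}=\left\langle 2,\frac{1+\theta+\theta^2+\theta^3}{4}\right\rangle^4$; \item if $v_2(m)=3$: $2\mathbb{O}_{\mathbb{K}_m}=\left\langle 2,\frac{(m^3+25m+4)\theta^3+(5m^2+168)\theta^2-(m^3+21m-56)\theta-m^2+8}{16}\right\rangle^2$; \item if $v_2(m)\geq 4$: $2\mathbb{O}_{\mathbb{K}_m}=\left\langle 2,\frac{2+7\theta+\theta^3}{4}\right\rangle^2\left\langle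 2,\frac{5+7\theta+\theta^3}{4}\right\rangle^2$. \end{enumerate} \end{enumerate}
   Context: For a number field $\mathbb{K}$ with ring of integers $\mathbb{O}_{\mathbb{K}}$, let $\widehat{\mathbb{O}}_{\mathbb{K}}$ be the set of primitive elements of $\mathbb{K}$ lying in $\mathbb{O}_{\mathbb{K}}$. For $\theta\in\widehat{\mathbb{O}}_{\mathbb{K}}$, the index of $\theta$ is $I(\theta)=(\mathbb{O}_{\mathbb{K}}:\mathbb{Z}[\theta])$, and the common index of $\mathbb{K}$ is $I(\mathbb{K})=\gcd_{\theta\in\widehat{\mathbb{O}}_{\mathbb{K}}} I(\theta)$. The notation $\langle a,b\rangle$ denotes the ideal of $\mathbb{O}_{\mathbb{K}_m}$ generated by $a$ and $b$. The fields $\mathbb{K}_m$ are the ''simplest quartic fields''.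
   Formalization: Two misprinted generators are corrected, as the printed elements are not integral: for v_2(m)=3 the coefficient m^3+25m+4 is replaced by m^3+25m+8, and for v_2(m)≥4 the second generator (5+7θ+θ^3)/4 is replaced by (6+7θ+θ^3)/4. *)

(* Defs.v *)
From HB Require Import structures.
From mathcomp Require Import all_boot all_order all_algebra all_field.
From mathcomp Require Import boolp classical_sets.
Set Implicit Arguments.
Unset Strict Implicit.
Unset Printing Implicit Defensive.
Import GRing.Theory.
Local Open Scope ring_scope.
Local Open Scope classical_set_scope.

Definition simplest_quartic (m : nat) : {poly rat} :=
  'X^4 - m%:R *: 'X^3 - 6 *: 'X^2 + m%:R *: 'X + 1.

Definition integers (K : fieldExtType rat) : set K :=
  [set x | integralOver (intr : int -> K) x].

Definition generates (K : fieldExtType rat) (a : K) : Prop :=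
  <<1; a>>%VS = {:K}%VS.

Definition primitive_integers (K : fieldExtType rat) : set K :=
  [set a | integers a /\ generates a].

(* Z[a], as a subset of K. *)
Definition Zadjoin (K : fieldExtType rat) (a : K) : set K :=
  [set x | exists p : {poly int}, x = (map_poly intr p).[a]].

(* (A : B) = n for additive subgroups B <= A of V: the cosets of B in A have
   a system of n representatives, each coset being represented once. *)
Definition has_index (V : zmodType) (A B : set V) (n : nat) : Prop :=
  exists r : 'I_n -> V,
    (forall i, A (r i)) /\ (forall x, A x -> exists! i, B (x - r i)).

Definition integer_index (K : fieldExtType rat) (a : K) (n : nat) : Prop :=
  has_index (@integers K) (Zadjoin a) n.

(* [d] divides I(a) for every primitive integer a (so every I(a) is finite). *)
Definition common_index_divisor (K : fieldExtType rat) (d : nat) : Prop :=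
  forall a : K, primitive_integers a -> exists2 n, integer_index a n & (d %| n)%N.

(* I(K) = g: [g] is the gcd of the I(a), a ranging over the primitive integers. *)
Definition common_index (K : fieldExtType rat) (g : nat) : Prop :=
  common_index_divisor K g /\
  (forall d, common_index_divisor K d -> (d %| g)%N).

Definition is_ideal (K : fieldExtType rat) (I : set K) : Prop :=
  [/\ I `<=` @integers K,
      I 0,
      (forall x y, I x -> I y -> I (x + y)) &
      (forall a x, integers a -> I x -> I (a * x))].

Definition is_prime_ideal (K : fieldExtType rat) (I : set K) : Prop :=
  [/\ is_ideal I,
      ~ I 1 &
      (forall x y, integers x -> integers y -> I (x * y) -> I x \/ I y)].

Definition ideal1 (K : fieldExtType rat) (a : K) : set K :=
  [set x | exists2 u, integers u & x = a * u].

Definition ideal2 (K : fieldExtType rat) (a b : K) : set K :=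
  [set x | exists u v, [/\ integers u, integers v & x = a * u + b * v]].

Definition ideal_mul (K : fieldExtType rat) (I J : set K) : set K :=
  [set x | exists n (a b : 'I_n -> K),
     (forall i, I (a i) /\ J (b i)) /\ x = \sum_(i < n) a i * b i].

Definition ideal_exp (K : fieldExtType rat) (I : set K) (n : nat) : set K :=
  iter n (ideal_mul I) (@integers K).

(* The generators of the prime ideals over 2 for m = 8 [mod 16] and for
   16 %| m come from the integer b = (2 + 7 theta + theta^3) / 4, by
   Dedekind's criterion: they are b^2 + b + 1 (expanded using the minimal
   equation of theta) in the first case, b and b + 1 in the second.  The source
   prints m^3 + 25 m + 4 for m^3 + 25 m + 8 and 5 + 7 theta + theta^3 for
   6 + 7 theta + theta^3; with the printed constants these two elements are
   not integral, hence generate no ideal of the ring of integers. *)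

(* Main.v *)
Require Import Defs.
From HB Require Import structures.
From mathcomp Require Import all_boot all_order all_algebra all_field.
From mathcomp Require Import boolp classical_sets ring zify.
Set Implicit Arguments.
Unset Strict Implicit.
Unset Printing Implicit Defensive.
Import Order.TTheory GRing.Theory Num.Theory.
Local Open Scope ring_scope.
Local Open Scope classical_set_scope.

(** With [eps = theta - theta^-1] one has [theta^2 = eps theta + 1] and
    [eps^2 = m eps + 4], so [K] is a tower of two quadratic extensions with
    middle field [k = Q(eps) = Q(sqrt (m^2 + 16))], and [m^2 + 16] is a square
    only for [m = 0, 3].  The integers [R = Z[omega]] of [k] are those of a
    quadratic field.  If [y = al + be theta] is integral, the relative trace and
    norm of [y] show that [eps s be] and [eps s be^2] lie in [R], where
    [s = 2 eps - m]; as the odd part of [s^2] is squarefree, only powers of [2]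
    can occur in the denominators of [al] and [be].  The powers of [2] are then
    removed by an argument local at [2], which depends on the valuation of [m]:
    - [m] odd: the integers are spanned by [R], [theta] and
      [rho = (1 + eps) (1 + theta) / 2];
    - [v(m) = 1] or [v(m) >= 3]: they are [R + R theta], and [theta + 1] has
      square [2] times a unit modulo [2];
    - [v(m) = 2]: [b = (1 + theta) (1 + theta^2) / 4] has fourth power [2]
      times a unit modulo [2].
    The factorizations of [2] are read off from these bases.  For the index,
    [I(a)] is the determinant of the coordinates of [1, a, a^2, a^3].
    The index of [theta] is a power of [2].  If [m] is even,
    [omega + theta] (or [b]) generates the integers modulo [2], so its index is
    odd.  If [m] is odd, [I(theta) = 2], and every integer is a root modulo [2]
    of a monic polynomial of degree at most [3], since the residue ring is
    [F_4 x F_4]; hence all indices are even. *)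

(** * Integers and ideals *)

Section Integers.
Variable K : fieldExtType rat.
Implicit Types (x y z : K) (I J : set K).

Lemma integersD x y : integers x -> integers y -> integers (x + y).
Proof. exact: integral_add. Qed.

Lemma integersN x : integers x -> integers (- x).
Proof. exact: integral_opp. Qed.

Lemma integersM x y : integers x -> integers y -> integers (x * y).
Proof. exact: integral_mul. Qed.

Lemma integers_nat n : integers (n%:R : K).
Proof. exact: integral_nat. Qed.

Lemma integers_int (n : int) : integers (n%:~R : K).
Proof. exact: integral_id. Qed.

Lemma integers0 : integers (0 : K). Proof. exact: integral0. Qed.

Lemma integers1 : integers (1 : K). Proof. exact: integral1. Qed.

Lemma integersX x n : integers x -> integers (x ^+ n).
Proof.
move=> Ox; elim: n => [|n IHn]; first exact: integers1.
by rewrite exprS; apply: integersM.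
Qed.

Lemma integers_sum (J : finType) (F : J -> K) :
  (forall j, integers (F j)) -> integers (\sum_j F j).
Proof.
by move=> OF; elim/big_ind: _ => //; [apply: integers0 | apply: integersD].
Qed.

Lemma integers_quadratic x t n :
  integers t -> integers n -> x ^+ 2 = t * x + n -> integers x.
Proof.
move=> Ot On xE.
have pE : Poly [:: - n; - t; 1] = [:: - n; - t; 1] :> seq K.
  by rewrite (PolyK (c := 1)) ?oner_eq0.
apply: (@integral_root_monic _ _ _ x (Poly [:: - n; - t; 1])).
- by rewrite monicE /lead_coef pE.
- by apply/eqP; rewrite horner_Poly /= mul0r add0r mul1r mulrBl -expr2 xE; ring.
- move=> y; rewrite pE !inE => /or3P[] /eqP->; first exact: integersN.
    exact: integersN.
  exact: integers1.
Qed.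

Lemma integers_rmorph (f : {rmorphism K -> K}) x : integers x -> integers (f x).
Proof.
case=> p mon_p px0; exists p => //.
have -> : map_poly intr p = map_poly f (map_poly intr p) :> {poly K}.
  by rewrite -map_poly_comp; apply: eq_map_poly => a /=; rewrite rmorph_int.
by rewrite rmorph_root.
Qed.

(** The monic integral equation is pulled back to [rat] and carried on to [algC], where a rational
    algebraic integer is an integer. *)
Lemma integers_rat (f : {rmorphism rat -> K}) (r : rat) :
  integers (f r) -> exists n : int, r = n%:~R.
Proof.
case=> p mon_p px0.
have px0Q : root (map_poly intr p : {poly rat}) r.
  rewrite -(fmorph_root f) -map_poly_comp.
  by rewrite (eq_map_poly (g := intr)) // => a /=; rewrite rmorph_int.
have : (ratr r : algC) \in Num.int.
  apply: Cint_rat_Aint; first by rewrite rpred_rat.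
  apply: (@root_monic_Aint (map_poly intr p)).
  - have -> : map_poly intr p = map_poly ratr (map_poly intr p : {poly rat}) :> {poly algC}.
      by rewrite -map_poly_comp; apply: eq_map_poly => a /=; rewrite ratr_int.
    by rewrite fmorph_root.
  - exact: monic_map.
  - by apply/polyOverP => i; rewrite coef_map /= rpred_int.
case/intrP => n rn; exists n; apply: (fmorph_inj (ratr : {rmorphism rat -> algC})).
by rewrite /= rn ratr_int.
Qed.

Lemma natr_K_neq0 n : (n.+1%:R : K) != 0.
Proof.
by rewrite -(rmorph_nat (in_alg K)) fmorph_eq0 pnatr_eq0.
Qed.

Lemma integers_half_int (a : int) :
  integers (a%:~R / 2 : K) -> exists b, a = 2 * b.
Proof.
have -> : (a%:~R / 2 : K) = in_alg K (a%:~R / 2).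
  by rewrite fmorph_div (rmorph_int (in_alg K)) (rmorph_nat (in_alg K)).
case/integers_rat => b abE; exists b; apply/eqP; rewrite -(@eqr_int rat).
by rewrite rmorphM /= -abE mulrC divfK.
Qed.

Lemma half_not_integer : ~ integers (1 / 2 : K).
Proof. by case/(@integers_half_int 1); lia. Qed.

End Integers.

Ltac ints := try solve [intros; repeat first [assumption | exact: integers0
  | exact: integers1 | exact: integers_nat | exact: integers_int
  | apply: integersD | apply: integersN | apply: integersM | apply: integersX]].

Lemma int_parity (a : int) : exists q, a = 2 * q \/ a = 2 * q + 1.
Proof. by exists (a %/ 2)%Z; lia. Qed.

(** * Ideal arithmetic and criteria for prime ideals containing 2 *)

Section Ideals.
Variable K : fieldExtType rat.
Implicit Types (a b g x y z : K) (I J L : set K).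
Local Notation O := (@integers K).

Lemma idealN I x : is_ideal I -> I x -> I (- x).
Proof. by case=> _ _ _ IM Ix; rewrite -mulN1r; apply: IM; ints. Qed.

Lemma idealB I x y : is_ideal I -> I x -> I y -> I (x - y).
Proof. by move=> idI Ix Iy; case: (idI) => _ _ ID _; apply: ID => //; apply: idealN. Qed.

Lemma ideal_lin I x y u v :
  is_ideal I -> I x -> I y -> O u -> O v -> I (x * u + y * v).
Proof.
by move=> [_ _ ID IM] *; apply: ID; rewrite mulrC; apply: IM.
Qed.

Lemma ideal_top I : is_ideal I -> I 1 -> I = O.
Proof.
move=> [IO _ _ IM] I1; apply/seteqP; split => // x Ox.
by rewrite -[x]mulr1; apply: IM.
Qed.

Lemma is_ideal_integers : is_ideal O.
Proof. by split; ints. Qed.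

Lemma is_ideal2 a b : O a -> O b -> is_ideal (ideal2 a b).
Proof.
move=> Oa Ob; split.
- by move=> _ [u [v [Ou Ov ->]]]; ints.
- by exists 0, 0; split; ints; ring.
- move=> _ _ [u [v [Ou Ov ->]]] [u' [v' [Ou' Ov' ->]]].
  by exists (u + u'), (v + v'); split; ints; ring.
- move=> c _ Oc [u [v [Ou Ov ->]]].
  by exists (c * u), (c * v); split; ints; ring.
Qed.

Lemma ideal2_l a b : ideal2 a b a.
Proof. by exists 1, 0; split; ints; ring. Qed.

Lemma ideal2_r a b : ideal2 a b b.
Proof. by exists 0, 1; split; ints; ring. Qed.

Lemma ideal2_sub I a b : is_ideal I -> I a -> I b -> ideal2 a b `<=` I.
Proof. by move=> idI Ia Ib _ [u [v [Ou Ov ->]]]; apply: ideal_lin. Qed.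

Lemma ideal2_eq a b c d : O a -> O b -> O c -> O d ->
    ideal2 c d a -> ideal2 c d b -> ideal2 a b c -> ideal2 a b d ->
  ideal2 a b = ideal2 c d.
Proof.
move=> Oa Ob Oc Od ca cb ac ad.
by apply/seteqP; split; apply: ideal2_sub => //; apply: is_ideal2.
Qed.

Lemma mem_ideal_mul I J a b : I a -> J b -> ideal_mul I J (a * b).
Proof.
move=> Ia Jb; exists 1%N, (fun=> a), (fun=> b); split=> //.
by rewrite big_ord1.
Qed.

(** [L] is only assumed additive, so that the principle also covers predicates such as lying in an
    ideal after multiplication by a fixed element, as in [ideal_mulA]. *)
Lemma ideal_mul_ind I J L : L 0 -> (forall x y, L x -> L y -> L (x + y)) ->
  (forall a b, I a -> J b -> L (a * b)) -> ideal_mul I J `<=` L.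
Proof.
move=> L0 LD LM _ [n [a [b [IJ ->]]]]; elim/big_ind: _ => // i _.
by have [? ?] := IJ i; apply: LM.
Qed.

Lemma is_ideal_mul I J : is_ideal I -> is_ideal J -> is_ideal (ideal_mul I J).
Proof.
move=> [IO I0 ID IM] [JO J0 JD JM]; split.
- apply: ideal_mul_ind; ints => a b /IO Oa /JO Ob; ints.
- by exists 0%N, (fun=> 0), (fun=> 0); split; [case | rewrite big_ord0].
- move=> _ _ [n [a [b [IJ ->]]]] [n' [a' [b' [IJ' ->]]]].
  pose cat T (f : 'I_n -> T) (h : 'I_n' -> T) (i : 'I_(n + n')) :=
    match fintype.split i with inl j => f j | inr j => h j end.
  exists (n + n')%N, (cat _ a a'), (cat _ b b'); split.
    by move=> i; rewrite /cat; case: (fintype.split i).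
  rewrite big_split_ord /cat /=; congr (_ + _); apply: eq_bigr => i _.
    by rewrite -[lshift _ i]/(unsplit (inl i)) unsplitK.
  by rewrite -[rshift _ i]/(unsplit (inr i)) unsplitK.
- move=> c _ Oc [n [a [b [IJ ->]]]].
  exists n, (fun i => c * a i), b; split.
    by move=> i; have [? ?] := IJ i; split=> //; apply: IM.
  by rewrite mulr_sumr; apply: eq_bigr => i _; rewrite mulrA.
Qed.

Lemma ideal_mul_sub I J L : is_ideal L ->
  (forall a b, I a -> J b -> L (a * b)) -> ideal_mul I J `<=` L.
Proof. by case=> _ L0 LD _; apply: ideal_mul_ind. Qed.

Lemma ideal_mulC I J : is_ideal I -> is_ideal J -> ideal_mul I J = ideal_mul J I.
Proof.
move=> idI idJ; apply/seteqP; split; apply: ideal_mul_sub;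
  by [apply: is_ideal_mul | move=> a b *; rewrite mulrC; apply: mem_ideal_mul].
Qed.

Lemma ideal_mulA I J L : is_ideal I -> is_ideal J -> is_ideal L ->
  ideal_mul I (ideal_mul J L) = ideal_mul (ideal_mul I J) L.
Proof.
move=> idI idJ idL; have idIJ := is_ideal_mul idI idJ.
have idJL := is_ideal_mul idJ idL.
have [_ IJL0 IJLD _] := is_ideal_mul idIJ idL.
have [_ IJL0' IJLD' _] := is_ideal_mul idI idJL.
apply/seteqP; split.
  apply: ideal_mul_ind => // a b Ia; move: b.
  apply: (@ideal_mul_ind J L (fun b => ideal_mul (ideal_mul I J) L (a * b))).
  - by rewrite mulr0.
  - by move=> x y Lx Ly; rewrite mulrDr; apply: IJLD.
  - move=> b c Jb Lc; rewrite mulrA.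
    by apply: mem_ideal_mul => //; apply: mem_ideal_mul.
apply: ideal_mul_ind => // a c Ia Lc; move: a Ia.
apply: (@ideal_mul_ind I J (fun a => ideal_mul I (ideal_mul J L) (a * c))).
- by rewrite mul0r.
- by move=> x y Lx Ly; rewrite mulrDl; apply: IJLD'.
- move=> a b Ia Jb; rewrite -mulrA.
  by apply: mem_ideal_mul => //; apply: mem_ideal_mul.
Qed.

Lemma ideal_mulO I : is_ideal I -> ideal_mul I O = I.
Proof.
move=> idI; apply/seteqP; split.
  by apply: ideal_mul_sub => // a b Ia Ob; rewrite mulrC; case: idI => _ _ _; apply.
by move=> x Ix; rewrite -[x]mulr1; apply: mem_ideal_mul; ints.
Qed.

Lemma ideal_exp2 I : is_ideal I -> ideal_exp I 2 = ideal_mul I I.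
Proof. by move=> idI; rewrite /ideal_exp /= ideal_mulO. Qed.

Lemma ideal_exp2M I J : is_ideal I -> is_ideal J ->
  ideal_mul (ideal_exp I 2) (ideal_exp J 2) = ideal_exp (ideal_mul I J) 2.
Proof.
move=> idI idJ; have idIJ := is_ideal_mul idI idJ.
rewrite !ideal_exp2 // -ideal_mulA //; last exact: is_ideal_mul.
rewrite -[RHS]ideal_mulA //; congr ideal_mul.
by rewrite [RHS]ideal_mulC // -ideal_mulA.
Qed.

Lemma is_ideal_exp I n : is_ideal I -> is_ideal (ideal_exp I n).
Proof.
move=> idI; elim: n => [|n IHn]; first exact: is_ideal_integers.
exact: is_ideal_mul.
Qed.

Lemma mem_ideal_exp I x n : I x -> ideal_exp I n (x ^+ n).
Proof.
move=> Ix; elim: n => [|n IHn]; first by rewrite expr0; apply: integers1.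
by rewrite exprS; apply: mem_ideal_mul.
Qed.

Lemma ideal_exp_top n : ideal_exp O n = O.
Proof.
elim: n => // n IHn.
exact: etrans (congr1 (ideal_mul O) IHn) (ideal_mulO is_ideal_integers).
Qed.

(** In a product of [n] elements of the ideal, every term of the expansion contains [a], except the
    multiple of [b ^+ n]. *)
Lemma ideal_exp2_sub a b n : O a -> O b ->
  ideal_exp (ideal2 a b) n `<=` ideal2 a (b ^+ n).
Proof.
move=> Oa Ob; elim: n => [|n IHn].
  by move=> x Ox; exists 0, x; split; ints; ring.
apply: ideal_mul_sub; first by apply: is_ideal2; ints.
move=> _ _ [u [v [Ou Ov ->]]] /IHn [u' [v' [Ou' Ov' ->]]].
exists (u * (a * u' + b ^+ n * v') + b * v * u'), (v * v'); split; ints.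
by rewrite exprS; ring.
Qed.

(* Modulo [P ^ n] the relation [b ^+ n * u' = 2 + 4 z] lets one replace [2] by
   multiples of [4], [8], ..., and finally of [2 ^+ n], which is in [P ^ n]. *)
Lemma ideal_exp_eq2 b u u' z n : O b -> O u -> O u' -> O z -> (0 < n)%N ->
    b ^+ n = 2 * u -> u * u' = 1 + 2 * z ->
  ideal_exp (ideal2 2 b) n = ideal1 2.
Proof.
move=> Ob Ou Ou' Oz n_gt0 bn uu'.
have idP : is_ideal (ideal2 2 b) by apply: is_ideal2; ints.
have [_ _ PnD PnM] := is_ideal_exp n idP.
apply/seteqP; split.
  move=> x /ideal_exp2_sub[]; ints => v [w [Ov Ow ->]].
  by exists (v + u * w); ints; rewrite bn; ring.
suff Pn2 : ideal_exp (ideal2 2 b) n 2.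
  by move=> _ [v Ov ->]; rewrite mulrC; apply: PnM.
have key k : exists2 y, O y & ideal_exp (ideal2 2 b) n (2 - 2 ^+ k.+1 * y).
  elim: k => [|k [y Oy Py]].
    exists 1; ints; rewrite expr1 mulr1 subrr.
    by case: (is_ideal_exp n idP).
  exists (- (z * y)); ints.
  have -> : 2 - 2 ^+ k.+2 * - (z * y) = (2 - 2 ^+ k.+1 * y)
     + 2 ^+ k * y * u' * b ^+ n :> K.
    rewrite bn.
    have -> : 2 ^+ k * y * u' * (2 * u) = 2 ^+ k * y * 2 * (u * u') by ring.
    by rewrite uu' !exprS; ring.
  by apply: PnD => //; apply: PnM; ints; apply/mem_ideal_exp/ideal2_r.
case: n n_gt0 {bn} PnD PnM key => // n _ PnD PnM /(_ n)[y Oy Py].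
have := PnD _ (2 ^+ n.+1 * y) Py; rewrite subrK; apply.
by rewrite mulrC; apply: PnM => //; apply/mem_ideal_exp/ideal2_l.
Qed.

Lemma ideal1_2_proper : ~ ideal1 2 (1 : K).
Proof.
case=> u Ou u2; apply: (@half_not_integer K).
suff -> : 1 / 2 = u by [].
by rewrite [X in X / _]u2 mulrAC divff ?mul1r // natr_K_neq0.
Qed.

(** If the ideal were everything, so would be its powers, but 2 is not a unit. *)
Lemma ideal_exp_proper b n : O b ->
  ideal_exp (ideal2 2 b) n = ideal1 2 -> ~ ideal2 2 b 1.
Proof.
move=> Ob PnE /ideal_top PO; apply: ideal1_2_proper.
by rewrite -PnE PO ?ideal_exp_top; ints; apply: is_ideal2; ints.
Qed.

(** Every element outside [I] is invertible modulo [I], so [I] is even maximal. *)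
Lemma prime_ideal_of_inv I : is_ideal I -> ~ I 1 ->
    (forall x, O x -> I x \/ exists2 y, O y & I (x * y - 1)) ->
  is_prime_ideal I.
Proof.
move=> idI I1 invI; have [_ _ ID IM] := idI; split=> // x y Ox Oy Ixy.
have [|[x' Ox' Ixx']] := invI x Ox; [by left | right].
have -> : y = x' * (x * y) - y * (x * x' - 1) by ring.
by apply: idealB => //; apply: IM.
Qed.

Lemma prime_ideal_F2 I : is_ideal I -> ~ I 1 -> I 2 ->
    (forall x, O x -> exists a : int, I (x - a%:~R)) ->
  is_prime_ideal I.
Proof.
move=> idI I1 I2 F2; have [_ _ ID IM] := idI.
apply: prime_ideal_of_inv => // x /F2[a].
have [q [] ->] := int_parity a; move=> Ixa; [left | right; exists 1; ints].
  have -> : x = (x - (2 * q)%:~R) + q%:~R * 2 by ring.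
  by apply: ID => //; apply: IM; ints.
have -> : x * 1 - 1 = (x - (2 * q + 1)%:~R) + q%:~R * 2 by ring.
by apply: ID => //; apply: IM; ints.
Qed.

Lemma F4_cases I g x (a b : int) : is_ideal I -> I 2 -> O g ->
    I (x - (a%:~R + b%:~R * g)) ->
  [\/ I x, I (x - 1), I (x - g) | I (x - (1 + g))].
Proof.
move=> idI I2 Og Ix; have [_ _ ID IM] := idI.
have [q aE] := int_parity a; have [r bE] := int_parity b.
have I2qr : I ((q%:~R + r%:~R * g) * 2) by apply: IM; ints.
have := ID _ _ Ix I2qr.
case: aE bE => -> [] -> Iqr; [apply: Or41 | apply: Or43 | apply: Or42 | apply: Or44];
  by move: Iqr; congr (I _); ring.
Qed.

(** The residue ring is F_4, generated by [g]: since [g * (1 + g)] is -1 modulo [I], the elements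
    [g] and [1 + g] are inverse to each other up to sign. *)
Lemma prime_ideal_F4 I g : is_ideal I -> ~ I 1 -> I 2 -> O g ->
    I (g ^+ 2 + g + 1) ->
    (forall x, O x -> exists a b : int, I (x - (a%:~R + b%:~R * g))) ->
  is_prime_ideal I.
Proof.
move=> idI I1 I2 Og Ig F4; have [_ _ ID IM] := idI.
apply: prime_ideal_of_inv => // x /F4[a [b /(F4_cases idI I2 Og)]] [] Ix.
- by left.
- by right; exists 1; ints; rewrite mulr1.
- right; exists (- (1 + g)); ints.
  have -> : x * - (1 + g) - 1 = - (1 + g) * (x - g) - (g ^+ 2 + g + 1) by ring.
  by apply: idealB => //; apply: IM; ints.
- right; exists (- g); ints.
  have -> : x * - g - 1 = - g * (x - (1 + g)) - (g ^+ 2 + g + 1) by ring.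
  by apply: idealB => //; apply: IM; ints.
Qed.

(** In F_4, the elements 0 and 1 are the roots of X^2 + X, the other two those of X^2 + X + 1. *)
Lemma F4_quadratic I g x : is_ideal I -> I 2 -> O g -> I (g ^+ 2 + g + 1) ->
    O x -> (exists a b : int, I (x - (a%:~R + b%:~R * g))) ->
  I (x ^+ 2 + x) \/ I (x ^+ 2 + x + 1).
Proof.
move=> idI I2 Og Ig Ox [a [b /(F4_cases idI I2 Og)]]; have [_ _ ID IM] := idI.
case=> Ix; [left | left | right | right].
- by rewrite expr2; apply: ID => //; apply: IM.
- have -> : x ^+ 2 + x = (x + 2) * (x - 1) + 1 * 2 by ring.
  by apply: ID => //; apply: IM; ints.
- have -> : x ^+ 2 + x + 1 = (x + g + 1) * (x - g) + (g ^+ 2 + g + 1) by ring.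
  by apply: ID => //; apply: IM; ints.
- have -> : x ^+ 2 + x + 1 =
      (x + g + 2) * (x - (1 + g)) + (g ^+ 2 + g + 1 + (1 + g) * 2) by ring.
  by apply: (ID); [apply: IM; ints | apply: (ID) => //; apply: IM; ints].
Qed.

End Ideals.

(** * The index of a lattice and of an integer *)

Section Index.

(** Sending a representative of the first system to the one of the second system in its coset is
    injective. *)
Lemma has_index_leq (V : zmodType) (A B : set V) n n' :
    B 0 -> (forall x y, B x -> B y -> B (x - y)) ->
  has_index A B n -> has_index A B n' -> (n <= n')%N.
Proof.
move=> B0 BB [r [Ar rP]] [r' [Ar' rP']].
have /choice[f fP] i : exists j, B (r i - r' j).
  by have [j [Bj _]] := rP' _ (Ar i); exists j.
suff /leq_card : injective f by rewrite !card_ord.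
move=> i j fij; have [k [_ k_uniq]] := rP _ (Ar i).
rewrite -[i]k_uniq ?subrr //; apply: k_uniq.
have := BB _ _ (fP i) (fP j); rewrite fij.
by rewrite opprB addrA subrK.
Qed.

Lemma has_index_unique (V : zmodType) (A B : set V) n n' :
    B 0 -> (forall x y, B x -> B y -> B (x - y)) ->
  has_index A B n -> has_index A B n' -> n = n'.
Proof.
by move=> B0 BB An An'; apply/eqP; rewrite eqn_leq !(@has_index_leq V A B).
Qed.

Lemma has_index_finType (V : zmodType) (A B : set V) (T : finType) (r : T -> V) :
    (forall t, A (r t)) -> (forall x, A x -> exists! t, B (x - r t)) ->
  has_index A B #|T|.
Proof.
move=> Ar rP; exists (fun i => r (enum_val i)); split=> [i|x Ax]; first exact: Ar.
have [t [Bt t_uniq]] := rP x Ax; exists (enum_rank t).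
split=> [|i Bi]; first by rewrite enum_rankK.
by rewrite (t_uniq _ Bi) enum_valK.
Qed.

Lemma absz_unit (a : int) : a \is a GRing.unit -> `|a|%N = 1%N.
Proof. by move=> /orP[] /eqP->. Qed.

(** In the Smith normal form [M = L D R], the outer factors are unimodular. The cosets are
    represented by the vectors with i-th entry between 0 and [|e_i| - 1], multiplied by [R]; their
    number is the absolute value of the product of the [e_i]. *)
Lemma has_index_lattice n (M : 'M[int]_n) : \det M != 0 ->
  has_index setT [set v : 'rV[int]_n | exists u, v = u *m M] `|\det M|.
Proof.
have [L uL [R uR [d _ ->]]] := int_Smith_normal_form M.
pose e := \row_(i < n) d`_i.
have -> : \matrix_(i < n, j < n) (d`_i *+ (i == j :> nat)) = diag_mx e.
  by apply/matrixP=> i j; rewrite !mxE.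
rewrite !det_mulmx det_diag !mulf_eq0 !negb_or => /andP[/andP[_ nz_e] _].
have e_neq0 i : e 0 i != 0 by apply: contraNneq nz_e => ei0; rewrite (bigD1 i) //= ei0 mul0r.
pose T := {dffun forall i : 'I_n, 'I_(`|e 0%R i|)}.
have -> : absz (\det L * \prod_(i < n) e 0 i * \det R) = #|T|.
  rewrite !abszM (absz_unit uL) (absz_unit uR) mul1n muln1.
  rewrite [RHS](card_dep_ffun (fun i : 'I_n => 'I_(absz (e 0 i)))) foldrE big_map.
  rewrite big_enum /= (big_morph absz (id1 := 1%N) (op1 := muln) abszM) //.
  by apply: eq_bigr => i _; rewrite card_ord.
(* Membership in the row lattice is a divisibility of each coordinate once [R] is undone. *)
have inL (v : 'rV[int]_n) : (exists u, v = u *m (L *m diag_mx e *m R)) <->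
    (forall i, (e 0%R i %| (v *m invmx R)%R 0%R i)%Z).
  split=> [[u ->] i | dv].
    rewrite !mulmxA mulmxK // mul_mx_diag mxE.
    exact: dvdz_mull.
  exists ((\row_i ((v *m invmx R)%R 0%R i %/ e 0%R i)%Z) *m invmx L).
  rewrite !mulmxA mulmxKV // -[LHS](mulmxKV uR); congr (_ *m _).
  by apply/rowP => i; rewrite mul_mx_diag [RHS]mxE [X in X * _]mxE divzK.
apply: (@has_index_finType _ _ _ T (fun t => (\row_i (t i : nat)%:Z) *m R)) => //.
move=> x _; have [y yE] : exists y, y = x *m invmx R by exists (x *m invmx R).
have xtE (t : T) i : ((x - \row_i (t i : nat)%:Z *m R) *m invmx R) 0 i = y 0 i - (t i : nat)%:Z.
  by rewrite mulmxBl mulmxK // -yE !mxE.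
have y_lt i : (`|(y 0%R i %% e 0%R i)%Z| < `|e 0%R i|)%N.
  by have := ltz_mod (y 0%R i) (e_neq0 i); have := modz_ge0 (y 0%R i) (e_neq0 i); lia.
exists (finfun (fun i => Ordinal (y_lt i)) : T); split.
  apply/inL => i; rewrite xtE ffunE /= gez0_abs ?modz_ge0 //.
  by rewrite {1}(divz_eq (y 0%R i) (e 0%R i)) addrK dvdz_mull.
move=> t /inL xt; apply/ffunP => i; rewrite ffunE; apply/val_inj => /=.
have := xt i; rewrite xtE.
rewrite -eqz_mod_dvd => /eqP ->.
have ti := ltn_ord (t i); rewrite -(modz_abs (t i : nat)) abszE.
by rewrite modz_nat absz_nat modn_small.
Qed.

End Index.

(** * Integral bases, and indices as determinants of power matrices *)

Section IntegralBasis.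
Variables (K : fieldExtType rat) (n : nat) (w : 'I_n -> K).
Implicit Types (a x y : K).

Definition lincomb (c : 'rV[int]_n) : K := \sum_i (c 0 i)%:~R * w i.

Definition integral_basis : Prop :=
  [/\ forall i, integers (w i),
      forall x, integers x -> exists c, x = lincomb c &
      forall c, lincomb c = 0 -> c = 0].

Hypothesis w_basis : integral_basis.

Lemma lincombB c d : lincomb (c - d) = lincomb c - lincomb d.
Proof.
rewrite /lincomb -sumrB; apply: eq_bigr => i _.
by rewrite !mxE rmorphB mulrBl.
Qed.

Lemma lincombZ (k : int) c : lincomb (k *: c) = k%:~R * lincomb c.
Proof.
by rewrite /lincomb mulr_sumr; apply: eq_bigr => i _; rewrite !mxE rmorphM mulrA.
Qed.

Lemma lincomb_sum (c : 'I_n -> 'rV[int]_n) :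
  lincomb (\sum_i c i) = \sum_i lincomb (c i).
Proof.
rewrite /lincomb exchange_big; apply: eq_bigr => i _ /=.
by rewrite summxE rmorph_sum mulr_suml.
Qed.

Lemma lincomb_delta i : lincomb (delta_mx 0 i) = w i.
Proof.
rewrite /lincomb (bigD1 i) //= mxE !eqxx mul1r big1 ?addr0 // => j ji.
by rewrite mxE (negPf ji) andbF mul0r.
Qed.

Lemma lincomb_inj : injective lincomb.
Proof.
case: w_basis => _ _ w_free c d cd; apply/subr0_eq/w_free.
by rewrite lincombB cd subrr.
Qed.

Lemma integers_lincomb c : integers (lincomb c).
Proof. by case: w_basis => Ow _ _; apply: integers_sum => i; have := Ow i; ints. Qed.

Lemma lincomb_mulmx (c : 'rV[int]_n) (M : 'M[int]_n) :
  lincomb (c *m M) = \sum_i (c 0 i)%:~R * lincomb (row i M).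
Proof.
rewrite mulmx_sum_row lincomb_sum; apply: eq_bigr => i _.
by rewrite lincombZ.
Qed.

Lemma coord_matrix (f : 'I_n -> K) : (forall i, integers (f i)) ->
  exists M : 'M[int]_n, forall i, f i = lincomb (row i M).
Proof.
case: w_basis => _ w_span _ Of.
have /choice[c cE] i : exists c, f i = lincomb c by apply: w_span.
by exists (\matrix_i c i) => i; rewrite rowK.
Qed.

(** Multiplication by [a] has an integer matrix in the basis, and the vector of basis elements is an
    eigenvector for [a]. The transpose appears because eigenvectors are rows here. *)
Lemma integer_charpoly a : (0 < n)%N -> integers a ->
  exists p : {poly int}, [/\ p \is monic, size p = n.+1 & root (map_poly intr p) a].
Proof.
move=> n_gt0 Oa; have [Ow w_span w_free] := w_basis.
have [|M ME] := @coord_matrix (fun i => a * w i); first by move=> i; have := Ow i; ints.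
exists (char_poly M^T); split; rewrite ?char_poly_monic ?size_char_poly //.
rewrite map_char_poly -eigenvalue_root_char; apply/eigenvalueP.
exists (\row_i w i).
  apply/rowP => i; rewrite !mxE ME; apply: eq_bigr => j _.
  by rewrite !mxE mulrC.
pose i0 := Ordinal n_gt0; apply/eqP => /rowP w0.
have : lincomb (delta_mx 0 i0) = 0.
  by apply: big1 => i _; have := w0 i; rewrite !mxE => ->; rewrite mulr0.
by move/w_free/rowP/(_ i0); rewrite !mxE !eqxx.
Qed.

(** Division by the monic characteristic polynomial of [a] leaves a remainder of degree less than
    [n]. *)
Lemma Zadjoin_span a x : (0 < n)%N -> integers a -> Zadjoin a x ->
  exists c : 'rV[int]_n, x = \sum_i (c 0 i)%:~R * a ^+ i.
Proof.
move=> n_gt0 Oa [q ->]; have [p [mon_p sz_p pa0]] := integer_charpoly n_gt0 Oa.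
exists (\row_i (Pdiv.Ring.rmodp q p)`_i).
rewrite {1}(Pdiv.RingMonic.rdivp_eq mon_p q) rmorphD rmorphM hornerD hornerM /=.
rewrite (rootP pa0) mulr0 add0r.
have sz_r : (size (map_poly intr (Pdiv.Ring.rmodp q p) : {poly K}) <= n)%N.
  rewrite (leq_trans (size_poly _ _)) //.
  by rewrite -ltnS -sz_p Pdiv.Ring.ltn_rmodp // monic_neq0.
rewrite (horner_coef_wide _ sz_r); apply: eq_bigr => i _.
by rewrite coef_map mxE.
Qed.

Section PowerMatrix.
Variables (a : K) (M : 'M[int]_n).
Hypotheses (n_gt0 : (0 < n)%N) (Oa : integers a).
Hypothesis ME : forall i : 'I_n, a ^+ i = lincomb (row i M).

Lemma power_sumE (c : 'rV[int]_n) :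
  \sum_i (c 0 i)%:~R * a ^+ i = lincomb (c *m M).
Proof. by rewrite lincomb_mulmx; apply: eq_bigr => i _; rewrite ME. Qed.

Lemma Zadjoin_lincomb c : Zadjoin a (lincomb c) <-> exists u, c = u *m M.
Proof.
split=> [/(Zadjoin_span n_gt0 Oa)[u]|[u ->]].
  by rewrite power_sumE => /lincomb_inj ->; exists u.
rewrite -power_sumE; exists (\poly_(i < n) (if insub i is Some j then u 0 j else 0)).
rewrite (@horner_coef_wide _ n); last first.
  by rewrite (leq_trans (size_poly _ _)) // size_poly.
by apply: eq_bigr => i _; rewrite coef_map coef_poly ltn_ord valK.
Qed.

Lemma integer_index_det : \det M != 0 -> integer_index a `|\det M|.
Proof.
move=> /has_index_lattice[r [_ rP]]; exists (lincomb \o r); split.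
  by move=> i; apply: integers_lincomb.
case: w_basis => _ w_span _ _ /w_span[c ->].
have [i [ci i_uniq]] := rP c I; exists i; split => [|j /=].
  by rewrite /= -lincombB; apply/Zadjoin_lincomb.
by rewrite -lincombB => /Zadjoin_lincomb; apply: i_uniq.
Qed.

(** A row vector killed by [M] is a polynomial of degree less than [n] vanishing at [a], whereas a
    generator has degree [n]. *)
Lemma det_power_neq0 : \dim {:K} = n -> generates a -> \det M != 0.
Proof.
move=> dimK gen_a; apply/negP => /det0P[v /negP nz_v vM]; apply: nz_v.
have deg_a : adjoin_degree 1 a = n.
  by have := dim_Fadjoin 1 a; rewrite dimv1 muln1 gen_a dimK.
pose p : {poly K} := \poly_(i < n) (if insub i is Some j then (v 0 j)%:~R else 0).
have p_over : p \is a polyOver (1%AS : {subfield K}).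
  apply/polyOver_poly => i _; case: insub => [j|]; last exact: mem0v.
  by rewrite rpred_int.
have : root p a.
  rewrite /root (@horner_coef_wide _ n) ?size_poly //.
  rewrite (eq_bigr (fun i : 'I_n => (v 0 i)%:~R * a ^+ i)).
    by rewrite power_sumE vM /lincomb big1 // => i _; rewrite mxE mul0r.
  by move=> i _; rewrite coef_poly ltn_ord valK.
rewrite (root_small_adjoin_poly p_over) ?deg_a ?size_poly // => /eqP p0.
apply/eqP/rowP => i; rewrite mxE; apply/eqP.
have /eqP := congr1 (fun q : {poly K} => q`_i) p0.
rewrite coef_poly ltn_ord valK coef0.
rewrite -(rmorph_int (in_alg K)) fmorph_eq0.
by rewrite intr_eq0.
Qed.

(** By the adjugate matrix, [\det M] times any integer is an integral combination of powers of [a];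
    hence [b] lies in the field generated by [a]. *)
Lemma generates_det (b : K) : \det M != 0 -> integers b -> generates b -> generates a.
Proof.
move=> nz_det Ob gen_b; apply/eqP; rewrite eqEsubv subvf -gen_b /=.
apply/FadjoinP; split; first exact: subv_adjoin.
case: w_basis => _ w_span _; have [c ->] := w_span b Ob.
have detK : (\det M)%:~R != 0 :> K.
  by rewrite -(rmorph_int (in_alg K)) fmorph_eq0 intr_eq0.
have -> : lincomb c = (\det M)%:~R^-1 * lincomb (c *m (\adj M *m M)).
  by rewrite mul_adj_mx mul_mx_scalar lincombZ mulKf.
rewrite mulmxA -power_sumE rpredM ?rpredV ?rpred_int //.
by apply: rpred_sum => i _; rewrite rpredM ?rpred_int ?rpredX ?memv_adjoin.
Qed.

(** The coefficients of [p] form a row vector that is nonzero modulo 2, since [p] is monic, and that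
    [M] kills modulo 2. *)
Lemma det_power_even (p : {poly int}) : p \is monic -> (size p <= n)%N ->
    (exists2 y, integers y & (map_poly intr p).[a] = 2 * y) ->
  (2 %| \det M)%Z.
Proof.
case: w_basis => _ w_span _ mon_p sz_p [_ /w_span[c ->] pa].
pose v := \row_(i < n) p`_i.
have vM : v *m M = 2 *: c.
  apply: lincomb_inj; rewrite -power_sumE lincombZ -[2%:~R]/(2%:R) -pa.
  rewrite (@horner_coef_wide _ n); last by rewrite (leq_trans (size_poly _ _)).
  by apply: eq_bigr => i _; rewrite coef_map mxE.
have two0 : (2%:~R : 'F_2) = 0 by apply/val_inj.
have : \det (map_mx intr M : 'M['F_2]_n) == 0.
  apply/det0P; exists (map_mx intr v).
    apply/eqP => /rowP v0.
    have sz_gt0 : (0 < size p)%N by rewrite size_poly_gt0 monic_neq0.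
    have lt_n : ((size p).-1 < n)%N by rewrite prednK.
    have := v0 (Ordinal lt_n); rewrite !mxE /=.
    by move: mon_p; rewrite monicE /lead_coef => /eqP->.
  by rewrite -map_mxM vM map_mxZ /= two0 scale0r.
rewrite det_map_mx => /eqP detM0.
have [q [] dE] := int_parity (\det M); first by rewrite dE dvdz_mulr.
by move: detM0; rewrite dE rmorphD rmorphM /= two0 mul0r add0r.
Qed.

(** If the powers of [a] span the integers modulo 2, then [M] has a left inverse over F_2. *)
Lemma det_power_odd :
    (forall i, exists x y, [/\ Zadjoin a x, integers y & w i = x + 2 * y]) ->
  ~~ (2 %| \det M)%Z.
Proof.
case: w_basis => _ w_span _ wE.
have /choice[N NE] i : exists uc : 'rV[int]_n * 'rV[int]_n,
    delta_mx 0 i = uc.1 *m M + 2 *: uc.2.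
  have [x [_ [/(Zadjoin_span n_gt0 Oa)[u ->] /w_span[c ->] wiE]]] := wE i.
  exists (u, c) => /=; apply/eqP; rewrite -subr_eq; apply/eqP/lincomb_inj.
  by rewrite lincombB lincombZ lincomb_delta wiE power_sumE addrK.
have : map_mx intr ((\matrix_i (N i).1) *m M) = 1%:M :> 'M['F_2]_n.
  apply/row_matrixP => i; rewrite -map_row row_mul rowK row1.
  have -> : (N i).1 *m M = delta_mx 0 i - 2 *: (N i).2 by rewrite NE addrK.
  rewrite map_mxB map_mxZ map_delta_mx /=.
  have -> : (2%:~R : 'F_2) = 0 by apply/val_inj.
  by rewrite scale0r subr0.
move/(congr1 determinant); rewrite det_map_mx det1 det_mulmx.
move=> detE; apply/negP => /dvdzP[q qE]; move: detE.
rewrite qE !rmorphM /=.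
by have -> : (2%:~R : 'F_2) = 0 by [apply/val_inj]; rewrite !mulr0.
Qed.

(** The hypothesis provides an integer matrix [N] with [N M = k]; take determinants. *)
Lemma det_power_dvd (k : nat) :
    (forall i, Zadjoin a (k%:R * w i)) -> (\det M %| Posz (k ^ n))%Z.
Proof.
move=> kw.
have /choice[N NE] i : exists u : 'rV[int]_n, (k : int) *: delta_mx 0 i = u *m M.
  apply/Zadjoin_lincomb; rewrite lincombZ lincomb_delta; exact: kw.
have : (\matrix_i N i) *m M = (k : int)%:M.
  apply/row_matrixP => i; rewrite row_mul rowK -NE.
  by rewrite -scalemx1 linearZ /= row1.
move/(congr1 determinant); rewrite det_mulmx det_scalar => detE.
apply/dvdzP; exists (\det (\matrix_i N i)); rewrite detE.
by rewrite -natz natrX natz.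
Qed.

End PowerMatrix.

(** For the divisor 1 the content is that every primitive integer has a finite index. *)
Lemma common_index_divisor_finite : (0 < n)%N -> \dim {:K} = n ->
  common_index_divisor K 1.
Proof.
move=> n_gt0 dimK a [Oa gen_a].
have [|M ME] := @coord_matrix (fun i => a ^+ i); first by move=> i; ints.
by exists `|\det M|%N => //; apply: integer_index_det => //; apply: det_power_neq0 ME _ _.
Qed.

(** The index of [th] divides a power of 2 and that of [b] is odd, so a divisor of both is 1. *)
Lemma common_index_eq1 (th b : K) k : (0 < n)%N -> \dim {:K} = n ->
    integers th -> generates th -> (forall i, Zadjoin th ((2 ^ k)%N%:R * w i)) ->
    integers b ->
    (forall i, exists x y, [/\ Zadjoin b x, integers y & w i = x + 2 * y]) ->
  common_index K 1.
Proof.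
move=> n_gt0 dimK Oth gen_th wth Ob wb; split.
  exact: common_index_divisor_finite.
(* A common divisor divides an index given by some system of representatives; uniqueness of the
   index identifies it with the determinant. *)
have idx c d M : integers c -> (forall i : 'I_n, c ^+ i = lincomb (row i M)) ->
    generates c -> common_index_divisor K d -> (d %| `|\det M|)%N.
  move=> Oc ME gen_c dP; have [] := dP c; first by split.
  move=> e ec de; have := @integer_index_det c M n_gt0 Oc ME.
  move/(_ (det_power_neq0 ME dimK gen_c)).
  suff <- : e = `|\det M|%N by [].
  apply: (has_index_unique _ _ ec).
  - by exists 0; rewrite rmorph0 horner0.
  - by move=> _ _ [p ->] [q ->]; exists (p - q); rewrite rmorphB hornerD hornerN.
  - exact: integer_index_det Oc ME (det_power_neq0 ME dimK gen_c).
move=> d dP.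
have [|M ME] := @coord_matrix (fun i => th ^+ i); first by move=> i; ints.
have [|N NE] := @coord_matrix (fun i => b ^+ i); first by move=> i; ints.
have odd_N := det_power_odd n_gt0 Ob NE wb.
have nz_N : \det N != 0 by apply: contraNneq odd_N => ->; rewrite dvdz0.
have gen_b := generates_det NE nz_N Oth gen_th.
have dM := idx _ _ _ Oth ME gen_th dP; have dN := idx _ _ _ Ob NE gen_b dP.
have := det_power_dvd n_gt0 Oth ME wth; rewrite dvdzE absz_nat => M2.
have : (d %| gcdn (2 ^ (k * n)) `|\det N|)%N.
  by rewrite dvdn_gcd dN andbT (dvdn_trans dM) // expnM.
suff /eqP-> : coprime (2 ^ (k * n)) `|\det N| by [].
by apply: coprimeXl; rewrite prime_coprime.
Qed.

(** A monic relation modulo 2 of degree less than [n] makes every index even, and [th] has index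
    exactly 2. *)
Lemma common_index_eq2 (th : K) (M : 'M[int]_n) : (0 < n)%N -> \dim {:K} = n ->
    integers th -> generates th -> (forall i : 'I_n, th ^+ i = lincomb (row i M)) ->
    `|\det M|%N = 2%N ->
    (forall a, integers a -> exists p : {poly int}, [/\ p \is monic, (size p <= n)%N &
      exists2 y, integers y & (map_poly intr p).[a] = 2 * y]) ->
  common_index K 2.
Proof.
move=> n_gt0 dimK Oth gen_th ME detM even_idx; split=> [a [Oa gen_a]|d dP].
  have [|N NE] := @coord_matrix (fun i => a ^+ i); first by move=> i; ints.
  exists `|\det N|%N; first exact: integer_index_det Oa NE (det_power_neq0 NE dimK gen_a).
  have [p [mon_p sz_p pa]] := even_idx a Oa.
  exact: (det_power_even NE mon_p sz_p pa).
have [//|e the de] := dP th.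
suff <- : e = 2%N by [].
apply: (has_index_unique _ _ the).
- by exists 0; rewrite rmorph0 horner0.
- by move=> _ _ [p ->] [q ->]; exists (p - q); rewrite rmorphB hornerD hornerN.
- rewrite -detM; apply: (integer_index_det n_gt0 Oth ME).
  by rewrite -absz_eq0 detM.
Qed.

End IntegralBasis.

(** * The quadratic tower and its Galois group *)

(** In lowest terms, the square of the denominator of [q] divides [D]. *)
Lemma squarefree_rat (D : nat) (q : rat) (z : int) :
    (forall p, prime p -> ~ (p ^ 2 %| D)%N) -> D%:R * q ^+ 2 = z%:~R ->
  exists c : int, q = c%:~R.
Proof.
case: (ratP q) => n d cop_nd D_sqf Dq.
have nz_d : (d.+1%:~R : rat) != 0 by rewrite intr_eq0.
have eqZ : (D : int) * n ^+ 2 = z * (d.+1 : int) ^+ 2.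
  apply/eqP; rewrite -(@eqr_int rat) rmorphM rmorphXn rmorphM rmorphXn /= -Dq.
  by apply/eqP; field; rewrite -mulrS pnatr_eq0.
have eqN : (D * `|n| ^ 2 = `|z| * d.+1 ^ 2)%N.
  by have := congr1 absz eqZ; rewrite !abszM.
have dD : (d.+1 ^ 2 %| D)%N.
  rewrite -(@Gauss_dvdl _ _ (`|n| ^ 2)); first by rewrite eqN dvdn_mull.
  by rewrite coprimeXl // coprimeXr // coprime_sym.
have d1 : d.+1 = 1%N.
  apply/eqP; have [//|d_neq1] := eqVneq; case: (D_sqf (pdiv d.+1)).
    by rewrite pdiv_prime //; lia.
  by apply: dvdn_trans dD; apply: dvdn_exp2r; apply: pdiv_dvd.
by exists n; rewrite d1 divr1.
Qed.

(** A rational root would be an integer, of absolute value [n > m] with (n - m)(n + m) = 16. This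
    bounds n - m, and only m = 3, n = 5 remains. *)
Lemma nonsquare_rat (m : nat) (r : rat) : (0 < m)%N -> m <> 3%N ->
  r ^+ 2 <> (m ^ 2 + 16)%:R.
Proof.
move=> m_gt0 m_neq3 rE.
have [||c cE] := @squarefree_rat 1 r (m ^ 2 + 16)%N.
- by move=> p /prime_gt1 p_gt1; rewrite dvdn1; nia.
- by rewrite mul1r rE.
have : (`|c| ^ 2)%N = (m ^ 2 + 16)%N.
  have cZ : c ^+ 2 = (m ^ 2 + 16)%N.
    by apply/eqP; rewrite -(@eqr_int rat) rmorphXn /= -cE rE.
  by have := congr1 absz cZ; rewrite abszX absz_nat.
move: `|c|%N => n nE; have lt_mn : (m < n)%N by nia.
have [d dE] : exists d, n = (m + d.+1)%N by exists (n - m).-1; lia.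
have : (d < 5)%N by subst n; nia.
by subst n; case: d nE {lt_mn} => [|[|[|[|[|d]]]]] //; lia.
Qed.

Lemma root_simplest_quartic (m : nat) (K : fieldExtType rat) (x : K) :
  root (map_poly (in_alg K) (simplest_quartic m)) x =
    (x ^+ 4 - m%:R * x ^+ 3 - 6 * x ^+ 2 + m%:R * x + 1 == 0).
Proof.
rewrite /root /simplest_quartic.
rewrite !(rmorphD, rmorphB, rmorphN) /= !map_polyZ !map_polyXn map_polyX rmorph1 /=.
by rewrite !hornerE /= !scaler_nat; congr (_ == 0); ring.
Qed.

Section QuarticField.
Variables (m : nat) (K : fieldExtType rat) (theta : K).
Hypothesis theta_root : root (map_poly (in_alg K) (simplest_quartic m)) theta.

Lemma theta_eq : theta ^+ 4 = m%:R * theta ^+ 3 + 6 * theta ^+ 2 - m%:R * theta - 1.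
Proof.
move: theta_root; rewrite root_simplest_quartic => /eqP tE.
by apply/eqP; rewrite -subr_eq0 -tE; apply/eqP; ring.
Qed.

Lemma theta_neq0 : theta != 0.
Proof.
apply/eqP => t0; have /eqP := theta_eq; rewrite t0 !expr0n /= !mulr0.
by rewrite add0r subr0 sub0r eq_sym oppr_eq0 oner_eq0.
Qed.

Local Notation eps := (theta - theta^-1).

Lemma theta_sqr : theta ^+ 2 = eps * theta + 1.
Proof. by field; exact: theta_neq0. Qed.

Lemma eps_sqr : eps ^+ 2 = m%:R * eps + 4.
Proof.
have t0 := theta_neq0; apply: (mulfI (expf_neq0 2 t0)).
have -> : theta ^+ 2 * eps ^+ 2 = theta ^+ 4 - 2 * theta ^+ 2 + 1 by field.
by rewrite theta_eq; field.
Qed.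

End QuarticField.

(** * The tower of two quadratic extensions and its generating automorphism *)

Section Tower.
Variables (m : nat) (K : fieldExtType rat) (theta eps : K).
Hypotheses (m_gt0 : (0 < m)%N) (m_neq3 : m <> 3%N).
Hypothesis theta_gen : generates theta.
Hypothesis theta_sqr : theta ^+ 2 = eps * theta + 1.
Hypothesis eps_sqr : eps ^+ 2 = m%:R * eps + 4.
Variable f : {rmorphism rat -> K}.

Lemma eps_free p q : f p + f q * eps = 0 -> p = 0 /\ q = 0.
Proof.
have [->|q_neq0] := eqVneq q 0.
  by rewrite rmorph0 mul0r addr0 => /eqP; rewrite fmorph_eq0 => /eqP.
move=> pq0; have [e epsE] : exists e, eps = f e.
  exists (- p / q); apply: (mulfI (_ : f q != 0)); first by rewrite fmorph_eq0.
  rewrite -rmorphM [q * _]mulrC divfK // rmorphN.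
  by apply/eqP; rewrite -subr_eq0 opprK addrC pq0.
have eE : e ^+ 2 = m%:R * e + 4.
  apply: (fmorph_inj f); rewrite rmorphXn rmorphD rmorphM !rmorph_nat -epsE.
  exact: eps_sqr.
case: (@nonsquare_rat m (2 * e - m%:R) m_gt0 m_neq3).
have -> : (2 * e - m%:R) ^+ 2 = 4 * e ^+ 2 - 4 * m%:R * e + m%:R ^+ 2 by ring.
by rewrite eE natrD natrX; ring.
Qed.

(* If [theta] were in [Q(eps)], the norm of [2 theta - eps], whose square is [4 (m^2 + 16)],
   would make [m^2 + 16] a rational square. *)
Lemma theta_not_quadratic u v : theta <> f u + f v * eps.
Proof.
move=> tE; pose z := 2 * v - 1.
have [uz uz'] : u ^+ 2 + 4 * v ^+ 2 - 4 * v - 1 = 0 /\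
    2 * u * v + m%:R * v ^+ 2 - u - m%:R * v = 0.
  apply: eps_free; have := theta_sqr; rewrite tE => /eqP.
  rewrite -subr_eq0 => /eqP <-.
  rewrite !(rmorphD, rmorphN, rmorphM, rmorphXn, rmorph_nat, rmorph1) /=.
  by ring: eps_sqr.
have uzE : 4 * u * z = m%:R * (1 - z ^+ 2).
  by apply/eqP; rewrite -subr_eq0 -[X in _ == X](mulr0 4) -uz' /z; apply/eqP; ring.
have u2E : u ^+ 2 = 2 - z ^+ 2.
  by apply/eqP; rewrite -subr_eq0 -uz /z; apply/eqP; ring.
(* With u^2 = 1 + y and z^2 = 1 - y, squaring 4 u z = m y gives 16 (1 - y^2) = m^2 y^2, hence y^2
   (m^2 + 16) = 16. *)
pose y := 1 - z ^+ 2.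
have yE : y ^+ 2 * (m ^ 2 + 16)%:R = 16.
  have : (4 * u * z) ^+ 2 = (m%:R * y) ^+ 2 by rewrite uzE.
  have -> : (4 * u * z) ^+ 2 = 16 * u ^+ 2 * z ^+ 2 by ring.
  have z2 : z ^+ 2 = 1 - y by rewrite /y; ring.
  rewrite u2E z2 natrD natrX => eqy.
  have -> : y ^+ 2 * (m%:R ^+ 2 + 16%:R) = (m%:R * y) ^+ 2 + 16 * y ^+ 2 by ring.
  by rewrite -eqy; ring.
have y_neq0 : y != 0.
  by apply/eqP => y0; move/eqP: yE; rewrite y0 expr0n mul0r.
apply: (@nonsquare_rat m (4 / y) m_gt0 m_neq3).
apply: (mulfI (expf_neq0 2 y_neq0)); rewrite yE expr_div_n mulrC divfK ?expf_neq0 //.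
Qed.

(** If the norm of r + t eps vanishes, then r = t = 0, because m^2 + 16 is not a square. Otherwise
    one divides by r + t eps, which puts [theta] in Q(eps). *)
Lemma tower_free p q r t :
  f p + f q * eps + (f r + f t * eps) * theta = 0 ->
  [/\ p = 0, q = 0, r = 0 & t = 0].
Proof.
have [/eqP n0|n_neq0] := eqVneq (r ^+ 2 + r * t * m%:R - 4 * t ^+ 2) 0.
  have [r0 t0] : r = 0 /\ t = 0.
    have [t0|t_neq0] := eqVneq t 0.
      by move: n0; rewrite t0; rewrite expr0n mulr0 mul0r mulr0 subr0 addr0 expf_eq0 /= => /eqP.
    case: (@nonsquare_rat m ((2 * r + m%:R * t) / t) m_gt0 m_neq3).
    apply: (mulfI (expf_neq0 2 t_neq0)).
    rewrite expr_div_n mulrC divfK ?expf_neq0 //.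
    apply/eqP; rewrite -subr_eq0 natrD natrX -[X in _ == X](mulr0 4) -(eqP n0).
    by apply/eqP; ring.
  rewrite r0 t0 rmorph0 mul0r addr0 mul0r addr0 => /eps_free[-> ->].
  by split.
move=> eq0; exfalso.
set n := _ - _ in n_neq0.
have nE : f n = (f r + f t * eps) * (f r + f t * m%:R - f t * eps).
  rewrite /n !(rmorphB, rmorphD, rmorphM, rmorphXn, rmorph_nat) /=.
  by ring: eps_sqr.
(* These are the coordinates of -(p + q eps) / (r + t eps), obtained with the conjugate r + t m - t
   eps and the norm [n]. *)
pose u := - (p * r + p * t * m%:R - 4 * q * t) / n.
pose v := - (q * r - p * t) / n.
apply: (@theta_not_quadratic u v).
apply: (mulfI (_ : f n != 0)); first by rewrite fmorph_eq0.
have -> : f n * (f u + f v * eps) = - ((f p + f q * eps) * (f r + f t * m%:R - f t * eps)).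
  rewrite mulrDr mulrA -!rmorphM [n * u]mulrC [n * v]mulrC !divfK //.
  rewrite !(rmorphB, rmorphD, rmorphN, rmorphM, rmorphXn, rmorph_nat) /=.
  by ring: eps_sqr.
have -> : f p + f q * eps = - ((f r + f t * eps) * theta).
  by apply/eqP; rewrite -addr_eq0 eq0.
by rewrite nE; ring.
Qed.

Hypothesis fE : forall q, f q = in_alg K q.

Lemma tower_span x : exists p q r t,
  x = f p + f q * eps + (f r + f t * eps) * theta.
Proof.
have : x \in <<1; theta>>%VS by rewrite theta_gen memvf.
case/Fadjoin1_polyP => P ->; elim/poly_ind: P => [|P c [p [q [r [t IH]]]]].
  by exists 0, 0, 0, 0; rewrite map_poly0 horner0; ring.
(* Multiplication by [theta] in the tower coordinates, followed by the addition of [c]. *)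
exists (r + c), t, (p + 4 * t), (q + r + t * m%:R).
rewrite [in LHS]rmorphD [in LHS]rmorphM /= map_polyX map_polyC hornerD hornerM hornerX hornerC IH.
rewrite /= -[c%:A]/(in_alg K c) -fE.
rewrite !(rmorphD, rmorphM, rmorph_nat) /=.
rewrite mulrDl -[_ * theta * theta]mulrA -expr2 theta_sqr.
by ring: eps_sqr.
Qed.

Lemma theta_powers_free (c : 'I_4 -> rat) :
  \sum_(i < 4) f (c i) * theta ^+ i = 0 -> forall i, c i = 0.
Proof.
rewrite !big_ord_recl big_ord0 /= /bump /= !addn0 expr0 expr1 => c0.
set c0' := c ord0 in c0; set c1 := c (lift _ _) in c0.
set c2 := c (lift _ _) in c0; set c3 := c (lift _ _) in c0.
(* The coordinates come from theta^2 = 1 + eps theta and theta^3 = eps + (5 + m eps) theta. *)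
have [] := @tower_free (c0' + c2) c3 (c1 + 5 * c3) (c2 + m%:R * c3).
  rewrite -[RHS]c0 !(rmorphD, rmorphM, rmorph_nat) /=.
  have -> : theta ^+ (1 + (1 + 1)) = (m%:R * eps + 5) * theta + eps.
    rewrite exprS theta_sqr mulrDr mulrCA -expr2 theta_sqr mulr1.
    by ring: eps_sqr.
  by rewrite theta_sqr; ring.
move=> + c3_0; rewrite c3_0 !mulr0 !addr0 => + c1_0 c2_0.
rewrite c2_0 addr0 => c0_0 [[|[|[|[|]]]]] // i_lt.
- by rewrite -[RHS]c0_0; congr c; apply/val_inj.
- by rewrite -[RHS]c1_0; congr c; apply/val_inj.
- by rewrite -[RHS]c2_0; congr c; apply/val_inj.
- by rewrite -[RHS]c3_0; congr c; apply/val_inj.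
Qed.

Hypothesis theta_root : root (map_poly (in_alg K) (simplest_quartic m)) theta.

Lemma simplest_quarticE :
  simplest_quartic m = Poly [:: 1; m%:R; - 6; - m%:R; 1].
Proof.
rewrite /= !cons_poly_def /simplest_quartic -!mul_polyC polyC0.
by rewrite polyCN polyC_natr polyC_natr; ring.
Qed.

Lemma size_simplest_quartic : size (simplest_quartic m) = 5.
Proof. by rewrite simplest_quarticE (PolyK (c := 1)) ?oner_eq0. Qed.

Lemma simplest_quartic_monic : simplest_quartic m \is monic.
Proof.
by rewrite monicE /lead_coef simplest_quarticE (PolyK (c := 1)) ?oner_eq0.
Qed.

(** The minimal polynomial divides the quartic, and a smaller degree would be a linear relation
    between 1, theta, theta^2 and theta^3. *)
Lemma size_minPoly_theta : size (minPoly 1 theta) = 5.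
Proof.
have P_over : map_poly (in_alg K) (simplest_quartic m) \is a polyOver (1%AS : {subfield K}).
  by apply/polyOver1P; exists (simplest_quartic m).
apply/eqP; rewrite eqn_leq; apply/andP; split.
  rewrite -size_simplest_quartic -(size_map_poly (in_alg K)).
  apply: dvdp_leq; last exact: minPoly_dvdp.
  by rewrite map_poly_eq0 monic_neq0 // simplest_quartic_monic.
rewrite ltnNge; apply/negP => sz_le.
have /polyOver1P[q qE] := minPolyOver 1 theta.
have sz_q : (size (map_poly (in_alg K) q) <= 4)%N by rewrite -qE.
have /eqP := minPolyxx 1 theta; rewrite qE (horner_coef_wide _ sz_q).
rewrite (eq_bigr (fun i : 'I_4 => f q`_i * theta ^+ i)); last first.
  by move=> i _; rewrite coef_map fE.
move/eqP/theta_powers_free => q0.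
have : q == 0.
  apply/eqP/polyP => i; rewrite coef0.
  have [i_lt|] := ltnP i 4; first exact: (q0 (Ordinal i_lt)).
  by move=> i_ge; rewrite nth_default // (leq_trans _ i_ge) // -(size_map_poly (in_alg K)).
have := monic_neq0 (monic_minPoly 1 theta).
by rewrite qE map_poly_eq0 => /negPf->.
Qed.

Lemma minPoly_theta : minPoly 1 theta = map_poly (in_alg K) (simplest_quartic m).
Proof.
apply/eqP; rewrite -eqp_monic ?monic_minPoly ?monic_map ?simplest_quartic_monic //.
rewrite -dvdp_size_eqp ?size_minPoly_theta ?size_map_poly ?size_simplest_quartic //.
apply: minPoly_dvdp => //; apply/polyOver1P; by exists (simplest_quartic m).
Qed.

Lemma dim_quartic : \dim {:K} = 4%N.
Proof.
have := dim_Fadjoin 1 theta; rewrite dimv1 muln1 theta_gen => ->.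
by have := size_minPoly 1 theta; rewrite size_minPoly_theta; move/succn_inj/esym.
Qed.

(** The map x -> (x - 1) / (x + 1) permutes the roots of P = [simplest_quartic m], because (x + 1)^4
    P((x - 1) / (x + 1)) = -4 P(x). *)
Lemma quartic_automorphism :
  exists sg : {rmorphism K -> K}, sg theta = (theta - 1) / (theta + 1).
Proof.
have t_neq0 : theta != 0.
  apply/eqP => t0; have /eqP := theta_sqr.
  by rewrite t0 expr0n mulr0 add0r eq_sym oner_eq0.
have t1_neq0 : theta + 1 != 0.
  apply/eqP => t1; have := @theta_not_quadratic (-1) 0; rewrite rmorphN1 rmorph0 mul0r addr0.
  by apply; apply/eqP; rewrite -subr_eq0 opprK t1.
pose y := (theta - 1) / (theta + 1).
have y_root : root (map_poly (\1%VF : 'End(K)) (minPoly 1 theta)) y.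
  rewrite map_poly_id => [|z _]; last by rewrite lfunE.
  rewrite minPoly_theta root_simplest_quartic.
  apply/eqP; apply: (mulfI (expf_neq0 4 t1_neq0)).
  have -> : (theta + 1) ^+ 4 * (y ^+ 4 - m%:R * y ^+ 3 - 6 * y ^+ 2 + m%:R * y + 1)
     = - 4 * (theta ^+ 4 - m%:R * theta ^+ 3 - 6 * theta ^+ 2 + m%:R * theta + 1).
    by rewrite /y; field.
  by move: theta_root; rewrite root_simplest_quartic => /eqP->; rewrite !mulr0.
have hom : kHom 1 {:K} (kHomExtend 1 (\1%VF : 'End(K)) theta y).
  have := kHomExtendP (subvv _) (kHom1 1 1) y_root.
  by rewrite [agenv _]theta_gen.
have sgM := kHom_monoid_morphism hom.
pose sg := kHomExtend 1 (\1%VF : 'End(K)) theta y : K -> K.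
pose sgm := GRing.isMonoidMorphism.Build _ _ sg sgM.
pose sga := GRing.isZmodMorphism.Build _ _ sg (raddfB _).
pose sgr : {rmorphism K -> K} := HB.pack sg sga sgm.
exists sgr; exact: kHomExtend_val (kHom1 1 1) y_root.
Qed.

End Tower.

(** * Integers of the tower, up to powers of 2 *)

(** The rational x / D satisfies D (x / D)^2 = z, so [squarefree_rat] applies to it. *)
Lemma squarefree_dvdz_sqr (D : nat) (x : int) :
    (0 < D)%N -> (forall p, prime p -> ~ (p ^ 2 %| D)%N) ->
  (exists z, x ^+ 2 = D%:Z * z) -> exists y, x = D%:Z * y.
Proof.
move=> D_gt0 D_sqf [z xE]; have nzD : (D%:R : rat) != 0 by rewrite pnatr_eq0 -lt0n.
have [|c cE] := @squarefree_rat D (x%:~R / D%:R) z D_sqf.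
  have -> : D%:R * (x%:~R / D%:R) ^+ 2 = (x ^+ 2)%:~R / D%:R :> rat.
    by rewrite rmorphXn /=; field.
  by rewrite xE rmorphM /=; field.
exists c; apply/eqP; rewrite -(@eqr_int rat) rmorphM /= -cE; apply/eqP; field.
exact: nzD.
Qed.

(** * Integers of the quadratic middle field *)

Section QuadraticIntegers.
Variables (K : fieldExtType rat) (f : {rmorphism rat -> K}).
Variables (sg : {rmorphism K -> K}) (omega : K) (A B : int).
Hypothesis omega_sqr : omega ^+ 2 = A%:~R * omega + B%:~R.
Hypothesis sg_omega : sg omega = A%:~R - omega.

Lemma intr_K_inj : injective (fun a : int => a%:~R : K).
Proof.
move=> a b /= ab; apply/eqP; rewrite -(@eqr_int rat); apply/eqP.
by apply: (fmorph_inj f); rewrite !rmorph_int.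
Qed.

Lemma conj_rat q : sg (f q) = f q.
Proof. by rewrite (fmorph_eq_rat f) fmorph_rat. Qed.

Lemma quad_trace_norm p q : integers (f p + f q * omega) ->
  exists t n : int, 2 * p + A%:~R * q = t%:~R /\
    p ^+ 2 + A%:~R * p * q - B%:~R * q ^+ 2 = n%:~R.
Proof.
move=> Ox; have Osx := integers_rmorph sg Ox.
have sxE : sg (f p + f q * omega) = f p + f q * (A%:~R - omega).
  by rewrite rmorphD rmorphM !conj_rat sg_omega.
have [|t tE] := @integers_rat K f (2 * p + A%:~R * q).
  have := integersD Ox Osx; rewrite sxE; congr integers.
  by rewrite !(rmorphD, rmorphM, rmorph_nat, rmorph_int) /=; ring.
have [|n nE] := @integers_rat K f (p ^+ 2 + A%:~R * p * q - B%:~R * q ^+ 2).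
  have := integersM Ox Osx; rewrite sxE; congr integers.
  rewrite !(rmorphD, rmorphN, rmorphM, rmorphXn, rmorph_nat, rmorph_int) /=.
  by ring: omega_sqr.
by exists t, n.
Qed.

(** With trace [t] and norm [n], D q^2 = t^2 - 4 n makes [q] an integer. Then 2 p is an integer, and
    the norm equation forces it to be even. *)
Lemma quad_integers_1 (D : nat) p q : A ^+ 2 + 4 * B = D ->
    (forall p, prime p -> ~ (p ^ 2 %| D)%N) -> integers (f p + f q * omega) ->
  exists a b : int, p = a%:~R /\ q = b%:~R.
Proof.
move=> DE D_sqf /quad_trace_norm[t [n [tE nE]]].
have [|b bE] := @squarefree_rat D q (t ^+ 2 - 4 * n) D_sqf.
  rewrite rmorphB rmorphXn rmorphM /= -tE -nE -[D%:R]/((D : int)%:~R) -DE.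
  by rewrite rmorphD rmorphM rmorphXn /=; ring.
have [h hE] : exists h : int, 2 * p = h%:~R.
  by exists (t - A * b); rewrite rmorphB rmorphM /= -tE bE; ring.
have : h ^+ 2 + 2 * A * h * b = 4 * n + 4 * B * b ^+ 2.
  apply/eqP; rewrite -(@eqr_int rat) !(rmorphD, rmorphM, rmorphXn) /= -hE -nE -bE.
  by apply/eqP; ring.
have [k [] kE] := int_parity h; rewrite kE => hn; last by exfalso; lia.
exists k, b; split=> //; move: hE; rewrite kE rmorphM /=.
by apply: mulfI.
Qed.

(** Now D (2 q)^2 = t^2 - 4 n only makes 2 q an integer; as D is 2 modulo 4, reduction modulo 4
    shows that [t] and 2 q are even. *)
Lemma quad_integers_2 (A' : int) (D : nat) p q : A = 2 * A' -> A' ^+ 2 + B = D ->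
    (D %% 4 = 2)%N -> (forall p, prime p -> ~ (p ^ 2 %| D)%N) ->
    integers (f p + f q * omega) ->
  exists a b : int, p = a%:~R /\ q = b%:~R.
Proof.
move=> AE DE D4 D_sqf /quad_trace_norm[t [n [tE nE]]].
have [|Q QE] := @squarefree_rat D (2 * q) (t ^+ 2 - 4 * n) D_sqf.
  rewrite rmorphB rmorphXn rmorphM /= -tE -nE -[D%:R]/((D : int)%:~R) -DE AE.
  by rewrite !(rmorphD, rmorphM, rmorphXn) /=; ring.
have : t ^+ 2 - 4 * n = D%:Z * Q ^+ 2.
  apply/eqP; rewrite -(@eqr_int rat) !(rmorphD, rmorphN, rmorphM, rmorphXn) /=.
  rewrite -QE -tE -nE -DE AE !(rmorphD, rmorphM, rmorphXn) /=.
  by apply/eqP; ring.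
have [e ->] : exists e : nat, D = (4 * e + 2)%N by exists (D %/ 4)%N; lia.
have [t' [] t'E] := int_parity t; have [b [] bE] := int_parity Q;
  rewrite t'E bE => tQ; try by exfalso; lia.
have qb : q = b%:~R by move: QE; rewrite bE rmorphM /=; apply: mulfI.
exists (t' - A' * b), b; split=> //; apply: (mulfI (_ : (2 : rat) != 0)) => //.
rewrite rmorphB rmorphM /=; move: tE; rewrite t'E AE qb !rmorphM /= => tE.
by apply/eqP; rewrite -(inj_eq (addIr (2 * A'%:~R * b%:~R))) tE; apply/eqP; ring.
Qed.

End QuadraticIntegers.

(** * Relative trace and discriminant: only powers of 2 occur in denominators *)

Section TowerIntegers.
Variables (K : fieldExtType rat) (f : {rmorphism rat -> K}).
Variables (sg : {rmorphism K -> K}) (theta eps omega : K) (m : nat).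
Variables (A B u w : int).
Hypothesis tower_span : forall x, exists p q r t,
  x = f p + f q * eps + (f r + f t * eps) * theta.
Hypothesis tower_free : forall p q r t,
  f p + f q * eps + (f r + f t * eps) * theta = 0 ->
  [/\ p = 0, q = 0, r = 0 & t = 0].
Hypothesis theta_sqr : theta ^+ 2 = eps * theta + 1.
Hypothesis eps_sqr : eps ^+ 2 = m%:R * eps + 4.
Hypothesis sg_eps : sg eps = m%:R - eps.
Hypothesis sg2_theta : sg (sg theta) = eps - theta.
Hypothesis omega_sqr : omega ^+ 2 = A%:~R * omega + B%:~R.
Hypothesis sg_omega : sg omega = A%:~R - omega.
Hypothesis epsE : eps = u%:~R * omega + w%:~R.
Hypothesis quad_integers : forall p q, integers (f p + f q * omega) ->
  exists a b : int, p = a%:~R /\ q = b%:~R.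

Local Notation O := (@integers K).

(* The order [Z[omega]]; by [quad_integers] it is the ring of integers of [Q(omega)]. *)
Definition quad_order (x : K) : Prop := exists a b : int, x = a%:~R + b%:~R * omega.

Local Notation R := quad_order.

Lemma quad_order_int (a : int) : R a%:~R.
Proof. by exists a, 0; ring. Qed.

Lemma quad_order_omega : R omega.
Proof. by exists 0, 1; ring. Qed.

Lemma quad_orderD x y : R x -> R y -> R (x + y).
Proof. by move=> [a [b ->]] [c [d ->]]; exists (a + c), (b + d); ring. Qed.

Lemma quad_orderM x y : R x -> R y -> R (x * y).
Proof.
move=> [a [b ->]] [c [d ->]]; exists (a * c + b * d * B), (a * d + b * c + b * d * A).
by ring: omega_sqr.
Qed.

Lemma quad_orderN x : R x -> R (- x).
Proof. by move=> [a [b ->]]; exists (- a), (- b); ring. Qed.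

Lemma quad_order_eps : R eps.
Proof. by exists w, u; rewrite epsE; ring. Qed.

Lemma integers_omega : O omega.
Proof. by apply: integers_quadratic omega_sqr; ints. Qed.

Lemma integers_eps : O eps.
Proof. by apply: integers_quadratic eps_sqr; ints. Qed.

Lemma integers_theta : O theta.
Proof. by apply: integers_quadratic theta_sqr; [exact: integers_eps | ints]. Qed.

Lemma integers_quad_order x : R x -> O x.
Proof. by have Oo := integers_omega; move=> [a [b ->]]; ints. Qed.

Definition quad_field (x : K) : Prop := exists p q : rat, x = f p + f q * omega.

Lemma quad_fieldD x y : quad_field x -> quad_field y -> quad_field (x + y).
Proof.
by move=> [a [b ->]] [c [d ->]]; exists (a + c), (b + d); rewrite !rmorphD; ring.
Qed.

Lemma quad_fieldM x y : quad_field x -> quad_field y -> quad_field (x * y).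
Proof.
move=> [a [b ->]] [c [d ->]].
exists (a * c + b * d * B%:~R), (a * d + b * c + b * d * A%:~R).
by rewrite !(rmorphD, rmorphM, rmorph_int) /=; ring: omega_sqr.
Qed.

Lemma quad_field_order x : R x -> quad_field x.
Proof. by move=> [a [b ->]]; exists a%:~R, b%:~R; rewrite !rmorph_int. Qed.

Lemma quad_order_integers x : quad_field x -> O x -> R x.
Proof.
move=> [p [q ->]] /quad_integers[a [b [-> ->]]]; exists a, b.
by rewrite !rmorph_int.
Qed.

Lemma u_neq0 : u != 0.
Proof.
apply/eqP => u0; have [] := @tower_free (- w%:~R) 1 0 0; last by move=> _ /eqP.
by rewrite epsE u0 !(rmorphN, rmorph_int, rmorph1, rmorph0) /=; ring.
Qed.

Lemma tower_spanR x : exists al be, [/\ quad_field al, quad_field be & x = al + be * theta].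
Proof.
have [p [q [r [t ->]]]] := tower_span x.
exists (f p + f q * eps), (f r + f t * eps); split=> //.
  exists (p + q * w%:~R), (q * u%:~R).
  by rewrite epsE !(rmorphD, rmorphM, rmorph_int) /=; ring.
exists (r + t * w%:~R), (t * u%:~R).
by rewrite epsE !(rmorphD, rmorphM, rmorph_int) /=; ring.
Qed.

Lemma tower_freeR (a b c d : int) :
  a%:~R + b%:~R * omega + (c%:~R + d%:~R * omega) * theta = 0 :> K ->
  [/\ a = 0, b = 0, c = 0 & d = 0].
Proof.
move=> eq0; have uf : f u%:~R != 0 by rewrite fmorph_eq0 intr_eq0 u_neq0.
have omE : omega = (eps - w%:~R) / f u%:~R 
  by rewrite epsE addrK -(rmorph_int f) mulrAC divff ?mul1r.
have uQ : (u%:~R : rat) != 0 by rewrite intr_eq0 u_neq0.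
have [] := @tower_free (a%:~R - b%:~R * w%:~R / u%:~R) (b%:~R / u%:~R)
                       (c%:~R - d%:~R * w%:~R / u%:~R) (d%:~R / u%:~R).
  rewrite -[RHS]eq0 omE !(rmorphB, rmorphM, fmorphV, rmorph_int) /=.
  by field; rewrite -(rmorph_int f).
move=> + /eqP; rewrite mulf_eq0 invr_eq0 (negPf uQ) orbF intr_eq0 => + /eqP b0.
rewrite b0 !mul0r subr0 => /eqP; rewrite intr_eq0 => /eqP a0.
move=> + /eqP; rewrite mulf_eq0 invr_eq0 (negPf uQ) orbF intr_eq0 => + /eqP d0.
rewrite d0 !mul0r subr0 => /eqP; rewrite intr_eq0 => /eqP c0.
by [].
Qed.

Lemma quad_order_free (a b : int) : a%:~R + b%:~R * omega = 0 :> K -> a = 0 /\ b = 0.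
Proof. by move=> ab0; have [|-> ->] // := @tower_freeR a b 0 0; rewrite ab0; ring. Qed.

Local Notation conj x := (sg (sg x)).

(** On the middle field [sg] is the involution exchanging [omega] and A - omega, so [sg \o sg] is
    the conjugation relative to that field. *)
Lemma conj_quad x : quad_field x -> conj x = x.
Proof.
move=> [p [q ->]]; rewrite !(rmorphD, rmorphM) /= !(conj_rat f sg) sg_omega.
by rewrite rmorphB rmorph_int sg_omega; ring.
Qed.

Lemma conj_tower al be : quad_field al -> quad_field be ->
  conj (al + be * theta) = al + be * (eps - theta).
Proof.
by move=> kal kbe; rewrite !(rmorphD, rmorphM) /= sg2_theta !conj_quad.
Qed.

Lemma conj_integers x : O x -> O (conj x).
Proof. by move=> /(integers_rmorph sg) /(integers_rmorph sg). Qed.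

Lemma relative_trace al be : quad_field al -> quad_field be ->
  O (al + be * theta) -> R (2 * al + eps * be).
Proof.
move=> kal kbe Oy; have Ocy := conj_integers Oy.
apply: quad_order_integers.
  by apply: quad_fieldD; apply: quad_fieldM => //; apply: quad_field_order;
    [exact: (quad_order_int 2) | exact: quad_order_eps].
have := integersD Oy Ocy; rewrite conj_tower //; congr integers; ring.
Qed.

Variables (Do c N : nat).
Hypothesis Do_gt0 : (0 < Do)%N.
Hypothesis Do_sqf : forall p, prime p -> ~ (p ^ 2 %| Do)%N.
Hypothesis DoE : A ^+ 2 + 4 * B = Do%:Z * c%:Z.
Hypothesis uwE : u * A + 2 * w = m%:Z.
Hypothesis DeltaE : (m ^ 2 + 16)%N%:Z = u ^+ 2 * (A ^+ 2 + 4 * B).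
Hypothesis cE : 8 * u * c%:Z = 2 ^+ N.

(** By [cE], [u] and [c] are powers of 2, so [Do] carries the odd part of the discriminant. A norm
    computation produces enough factors [Do] in the numerator of [be] to cancel those of its
    denominator eps^2 + 4. *)
Lemma two_power_denominator y : O y ->
  exists al be, [/\ R al, R be & 2 ^+ N.+1 * y = al + be * theta].
Proof.
move=> Oy; have [al [be [kal kbe yE]]] := tower_spanR y.
have [Ot Oe] := (integers_theta, integers_eps).
have kint (a : int) : quad_field a%:~R by apply/quad_field_order/quad_order_int.
have keps : quad_field eps by apply/quad_field_order/quad_order_eps.
have Rt1 : R (2 * al + eps * be) by apply: relative_trace; rewrite -?yE.
have Ocy := conj_integers Oy.
(* The discriminant eps^2 + 4 of [theta] over the middle field appears as twice the trace of y theta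
   minus eps times the trace of y. *)
have [g0 [g1 gE]] : R ((eps ^+ 2 + 4) * be).
  apply: quad_order_integers.
    apply: quad_fieldM => //; apply: quad_fieldD; last exact: (kint 4).
    exact: quad_fieldM.
  have Ot1 := integers_quad_order Rt1.
  have Oct : O (conj y * (eps - theta)) by ints.
  have : O (2 * (y * theta + conj y * (eps - theta)) - eps * (2 * al + eps * be)) by ints.
  rewrite yE conj_tower //; congr integers; by ring: theta_sqr.
(* This is the discriminant of [y]: the square of its trace minus four times its norm. *)
have [d0 [d1 dE]] : R ((eps ^+ 2 + 4) * be ^+ 2).
  apply: quad_order_integers.
    apply: quad_fieldM; last exact: quad_fieldM.
    apply: quad_fieldD; last exact: (kint 4).
    exact: quad_fieldM.
  have Ot1 := integers_quad_order Rt1.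
  have : O ((2 * al + eps * be) ^+ 2 - 4 * (y * conj y)) by ints.
  rewrite yE conj_tower //; congr integers; by ring: theta_sqr.
have mE : ((m ^ 2 + 16)%N%:Z)%:~R = m%:R ^+ 2 + 16 :> K.
  by rewrite -[LHS]/((m ^ 2 + 16)%N%:R) natrD natrX.
pose norm (a b : int) := a ^+ 2 + A * a * b - B * b ^+ 2.
have normE (a b : int) :
    (norm a b)%:~R = (a%:~R + b%:~R * omega) * sg (a%:~R + b%:~R * omega).
  rewrite (rmorphD sg) (rmorphM sg) !(rmorph_int sg) sg_omega /norm.
  by ring: omega_sqr.
(* The square of the first element is eps^2 + 4 times the second, and eps^2 + 4 has norm 4 (m^2 +
   16). *)
have ngE : norm g0 g1 ^+ 2 = 4 * (m ^ 2 + 16)%N%:Z * norm d0 d1.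
  apply: (intr_K_inj f); rewrite rmorphXn /= [in RHS]rmorphM [in RHS]rmorphM /= mE.
  rewrite !normE -gE -dE.
  rewrite !(rmorphM sg, rmorphD sg, rmorphXn sg, rmorph_nat sg) sg_eps.
  by ring: eps_sqr.
have [g gDo] : exists g, norm g0 g1 = Do%:Z * g.
  apply: squarefree_dvdz_sqr => //; exists (4 * u ^+ 2 * c%:Z * norm d0 d1).
  by rewrite ngE DeltaE DoE; ring.
(* Four times the norm is (2 g0 + A g1)^2 - (A^2 + 4 B) g1^2, and [Do] divides both the norm and the
   discriminant. *)
have [G' GE] : exists G', 2 * g0 + A * g1 = Do%:Z * G'.
  apply: squarefree_dvdz_sqr => //; exists (4 * g + c%:Z * g1 ^+ 2).
  rewrite mulrDr mulrCA -gDo mulrA -DoE /norm; ring.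
have DuK : (Do%:Z * u)%:~R != 0 :> K.
  rewrite -(rmorph_int f) fmorph_eq0 intr_eq0 mulf_neq0 ?u_neq0 //.
  by rewrite eqz_nat -lt0n.
(* Multiplying (eps^2 + 4) be by the conjugate of eps^2 + 4 gives 4 (m^2 + 16) be. After doubling
   and cancelling Do u on both sides, the coefficient of [be] is 8 u c = 2^N. *)
have beE : 2 ^+ N * be = - ((G'%:~R * (2 * omega - A%:~R) + (c%:Z * g1)%:~R) * (m%:R - eps)).
  apply: (mulfI DuK).
  have -> : 2 ^+ N = (8 * u * c%:Z)%:~R :> K by rewrite cE rmorphXn.
  have -> : (Do%:Z * u)%:~R * ((8 * u * c%:Z)%:~R * be) =
      8 * ((u ^+ 2 * (Do%:Z * c%:Z))%:~R * be) by ring.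
  have -> : 8 * ((u ^+ 2 * (Do%:Z * c%:Z))%:~R * be) =
      2 * ((eps ^+ 2 + 4) * be) * ((m%:R - eps) ^+ 2 + 4).
    by rewrite -DoE -DeltaE mE; ring: eps_sqr.
  rewrite gE.
  have -> : 2 * (g0%:~R + g1%:~R * omega) = (Do%:Z * G')%:~R + g1%:~R * (2 * omega - A%:~R) :> K.
    by rewrite -GE; ring.
  have -> : (m%:R - eps) ^+ 2 + 4 = - ((m%:R - eps) * (u%:~R * (2 * omega - A%:~R))).
    have -> : u%:~R * (2 * omega - A%:~R) = 2 * eps - m%:R.
      by rewrite epsE -[m%:R]/((m : int)%:~R) -uwE; ring.
    by ring: eps_sqr.
  have s2 : (2 * omega - A%:~R) ^+ 2 = (Do%:Z * c%:Z)%:~R.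
    by rewrite -DoE; ring: omega_sqr.
  move: s2; set s' := 2 * omega - A%:~R => s2.
  by ring: s2.
have Rbe : R (2 ^+ N * be).
  rewrite beE; apply: quad_orderN; apply: quad_orderM.
    apply: quad_orderD; last exact: quad_order_int.
    apply: quad_orderM; first exact: quad_order_int.
    apply: quad_orderD; last exact/quad_orderN/quad_order_int.
    by apply: quad_orderM; [exact: (quad_order_int 2) | exact: quad_order_omega].
  apply: quad_orderD; first exact: (quad_order_int m).
  exact/quad_orderN/quad_order_eps.
have R2N : R (2 ^+ N) by have := quad_order_int (2 ^+ N); rewrite rmorphXn.
(* The extra factor 2 comes from recovering [al] from the trace 2 al + eps be. *)
exists (2 ^+ N * (2 * al + eps * be) - eps * (2 ^+ N * be)), (2 * (2 ^+ N * be)); split.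
- apply: quad_orderD; first exact: quad_orderM.
  by apply/quad_orderN/quad_orderM => //; apply: quad_order_eps.
- by apply: quad_orderM => //; apply: (quad_order_int 2).
- by rewrite yE exprS; ring.
Qed.

End TowerIntegers.

Section Basis4.
Variables (K : fieldExtType rat) (w0 w1 w2 w3 : K).

Lemma integral_basis4 :
    integers w0 -> integers w1 -> integers w2 -> integers w3 ->
    (forall x, integers x -> exists a b c d : int,
       x = a%:~R * w0 + b%:~R * w1 + c%:~R * w2 + d%:~R * w3) ->
    (forall a b c d : int,
       a%:~R * w0 + b%:~R * w1 + c%:~R * w2 + d%:~R * w3 = 0 ->
       [/\ a = 0, b = 0, c = 0 & d = 0]) ->
  integral_basis (fun i : 'I_4 => [:: w0; w1; w2; w3]`_i).
Proof.
move=> O0 O1 O2 O3 w_span w_free.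
have linE c : lincomb (fun i : 'I_4 => [:: w0; w1; w2; w3]`_i) c =
    (c 0 0)%:~R * w0 + (c 0 1)%:~R * w1 + (c 0 2)%:~R * w2 + (c 0 3)%:~R * w3.
  rewrite /lincomb !big_ord_recl big_ord0 addr0 !addrA /=.
  by congr (_ + _ + _ + _); congr ((c 0 _)%:~R * _); apply/val_inj.
split=> [[[|[|[|[|]]]]] // | x /w_span[a [b [c [d ->]]]] | c].
  by exists (\row_(i < 4) [:: a; b; c; d]`_i); rewrite linE !mxE.
rewrite linE => /w_free[c0 c1 c2 c3]; apply/rowP => -[[|[|[|[|//]]]] i_lt]; rewrite mxE.
- by rewrite -[RHS]c0; congr (c 0 _); apply/val_inj.
- by rewrite -[RHS]c1; congr (c 0 _); apply/val_inj.
- by rewrite -[RHS]c2; congr (c 0 _); apply/val_inj.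
- by rewrite -[RHS]c3; congr (c 0 _); apply/val_inj.
Qed.

End Basis4.

(** * The ring Z[a], exactly and modulo 2 *)

Section Zadjoin.
Variables (K : fieldExtType rat) (a : K).
Implicit Types x y : K.

Lemma Zadjoin_int (n : int) : Zadjoin a n%:~R.
Proof. by exists n%:P; rewrite map_polyC hornerC. Qed.

Lemma Zadjoin_gen : Zadjoin a a.
Proof. by exists 'X; rewrite map_polyX hornerX. Qed.

Lemma ZadjoinD x y : Zadjoin a x -> Zadjoin a y -> Zadjoin a (x + y).
Proof. by move=> [p ->] [q ->]; exists (p + q); rewrite rmorphD hornerD. Qed.

Lemma ZadjoinM x y : Zadjoin a x -> Zadjoin a y -> Zadjoin a (x * y).
Proof. by move=> [p ->] [q ->]; exists (p * q); rewrite rmorphM hornerM. Qed.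

Lemma ZadjoinN x : Zadjoin a x -> Zadjoin a (- x).
Proof. by move=> [p ->]; exists (- p); rewrite rmorphN hornerN. Qed.

Lemma Zadjoin_nat n : Zadjoin a n%:R.
Proof. exact: (Zadjoin_int n). Qed.

Lemma Zadjoin1 : Zadjoin a 1. Proof. exact: (Zadjoin_nat 1). Qed.

Lemma ZadjoinX x n : Zadjoin a x -> Zadjoin a (x ^+ n).
Proof.
move=> ax; elim: n => [|n IHn]; first exact: Zadjoin1.
by rewrite exprS; apply: ZadjoinM.
Qed.

Hypothesis Oa : integers a.

Lemma integers_Zadjoin x : Zadjoin a x -> integers x.
Proof.
case=> p ->; apply: integral_horner => //; apply/integral_poly => i.
by rewrite coef_map; apply: integers_int.
Qed.

Definition Zadjoin_mod2 x : Prop :=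
  exists y z, [/\ Zadjoin a y, integers z & x = y + 2 * z].

Lemma Zadjoin_mod2W x : Zadjoin a x -> Zadjoin_mod2 x.
Proof. by exists x, 0; split; ints; rewrite mulr0 addr0. Qed.

Lemma Zadjoin_mod2D x y : Zadjoin_mod2 x -> Zadjoin_mod2 y -> Zadjoin_mod2 (x + y).
Proof.
move=> [u [v [au Ov ->]]] [u' [v' [au' Ov' ->]]].
by exists (u + u'), (v + v'); split; [exact: ZadjoinD | ints | ring].
Qed.

Lemma Zadjoin_mod2N x : Zadjoin_mod2 x -> Zadjoin_mod2 (- x).
Proof.
move=> [u [v [au Ov ->]]].
by exists (- u), (- v); split; [exact: ZadjoinN | ints | ring].
Qed.

Lemma Zadjoin_mod2M x y : Zadjoin_mod2 x -> Zadjoin_mod2 y -> Zadjoin_mod2 (x * y).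
Proof.
move=> [u [v [au Ov ->]]] [u' [v' [au' Ov' ->]]].
have [Ou Ou'] := (integers_Zadjoin au, integers_Zadjoin au').
exists (u * u'), (u * v' + v * u' + 2 * (v * v')).
by split; [exact: ZadjoinM | ints | ring].
Qed.

End Zadjoin.

Ltac zadjoin := by repeat first [assumption | exact: Zadjoin1 | exact: Zadjoin_gen
  | exact: Zadjoin_nat | exact: Zadjoin_int | apply: ZadjoinD | apply: ZadjoinN
  | apply: ZadjoinM | apply: ZadjoinX].

(** This removes a power of 2 from a denominator, one factor at a time, and reduces each local
    situation to the passage from 2 y to y. *)
Lemma pow2_descent (K : fieldExtType rat) (W : K -> Prop) N y :
    (forall y, integers y -> W (2 * y) -> W y) -> integers y -> W (2 ^+ N * y) -> W y.
Proof.
move=> desc Oy; elim: N => [|N IHN]; first by rewrite expr0 mul1r.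
by rewrite exprS -mulrA => /desc Wy; apply/IHN/Wy; ints.
Qed.

Lemma horner_map_Poly (K : fieldExtType rat) (s : seq int) (a : K) :
  (map_poly intr (Poly s)).[a] = foldr (fun c x => x * a + c%:~R) 0 s.
Proof.
elim: s => [|c s IHs] /=; first by rewrite map_poly0 horner0.
by rewrite cons_poly_def rmorphD rmorphM /= map_polyX map_polyC !hornerE IHs.
Qed.

(** * Total ramification: an element whose fourth power is 2 up to a unit modulo 2 *)

Section RamifiedChain.
Variables (K : fieldExtType rat) (b u v z : K).
Local Notation O := (@integers K).
Hypotheses (Ob : O b) (Ou : O u) (Ov : O v) (Oz : O z).
Hypotheses (b4 : b ^+ 4 = 2 * u) (uv : u * v = 1 + 2 * z).

Let two_neq0 : (2 : K) != 0. Proof. exact: natr_K_neq0. Qed.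

(* If [b^3 = 2 x], then [u^3 = 2 x^4], although [u] is a unit modulo [2]. *)
Lemma ramified_cube (k : int) y : O y -> k%:~R * b ^+ 3 = 2 * y ->
  exists k', k = 2 * k'.
Proof.
move=> Oy ky; have [k' [->|kE]] := int_parity k; first by exists k'.
case: (@half_not_integer K).
pose x := y - k'%:~R * b ^+ 3.
have Ox : O x by rewrite /x; ints.
have b3 : b ^+ 3 = 2 * x by rewrite /x mulrBr -ky kE; ring.
have : O (x ^+ 4 * v ^+ 3 - (3 * z + 6 * z ^+ 2 + 4 * z ^+ 3)) by ints.
congr integers; apply: (mulfI two_neq0); rewrite [RHS]mulrC divfK //.
have u3 : u ^+ 3 = 2 * x ^+ 4.
  apply: (mulfI (_ : (8 : K) != 0)); first exact: natr_K_neq0.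
  have -> : 8 * u ^+ 3 = (2 * u) ^+ 3 by ring.
  have -> : 8 * (2 * x ^+ 4) = (2 * x) ^+ 4 by ring.
  by rewrite -b4 -b3 -!exprM.
have -> : 2 * (x ^+ 4 * v ^+ 3 - (3 * z + 6 * z ^+ 2 + 4 * z ^+ 3)) =
  (2 * x ^+ 4) * v ^+ 3 - 2 * (3 * z + 6 * z ^+ 2 + 4 * z ^+ 3) by ring.
by rewrite -u3 -exprMn uv; ring.
Qed.

(** Multiplying successively by b^3, b^2, b and 1 turns all remaining terms but one into multiples
    of 2, so [ramified_cube] yields the coefficients one after the other. *)
Lemma ramified_chain (c0 c1 c2 c3 : int) y : O y ->
    c0%:~R + c1%:~R * b + c2%:~R * b ^+ 2 + c3%:~R * b ^+ 3 = 2 * y ->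
  exists d0 d1 d2 d3, [/\ c0 = 2 * d0, c1 = 2 * d1, c2 = 2 * d2 & c3 = 2 * d3].
Proof.
move=> Oy cE.
have [d0 c0E] : exists d0, c0 = 2 * d0.
  apply: (@ramified_cube c0 (y * b ^+ 3 - u * (c1%:~R + c2%:~R * b + c3%:~R * b ^+ 2))); ints.
  rewrite mulrBr !mulrA -cE -b4; ring.
have [d1 c1E] : exists d1, c1 = 2 * d1.
  apply: (@ramified_cube c1 ((y - d0%:~R) * b ^+ 2 - u * (c2%:~R + c3%:~R * b))); ints.
  have -> : 2 * ((y - d0%:~R) * b ^+ 2 - u * (c2%:~R + c3%:~R * b)) =
    (2 * y - (2 * d0)%:~R) * b ^+ 2 - 2 * u * (c2%:~R + c3%:~R * b) by ring.
  by rewrite -cE -b4 -c0E; ring.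
have [d2 c2E] : exists d2, c2 = 2 * d2.
  apply: (@ramified_cube c2 ((y - d0%:~R - d1%:~R * b) * b - u * c3%:~R)); ints.
  have -> : 2 * ((y - d0%:~R - d1%:~R * b) * b - u * c3%:~R) =
    (2 * y - (2 * d0)%:~R - (2 * d1)%:~R * b) * b - 2 * u * c3%:~R by ring.
  by rewrite -cE -b4 -c0E -c1E; ring.
have [d3 c3E] : exists d3, c3 = 2 * d3.
  apply: (@ramified_cube c3 (y - d0%:~R - d1%:~R * b - d2%:~R * b ^+ 2)); ints.
  have -> : 2 * (y - d0%:~R - d1%:~R * b - d2%:~R * b ^+ 2) =
    2 * y - (2 * d0)%:~R - (2 * d1)%:~R * b - (2 * d2)%:~R * b ^+ 2 by ring.
  by rewrite -cE -c0E -c1E -c2E; ring.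
by exists d0, d1, d2, d3.
Qed.

End RamifiedChain.

(** * The three local situations at 2 *)

Section Cases.
Variables (m : nat) (K : fieldExtType rat) (theta eps : K).
Variables (f : {rmorphism rat -> K}) (sg : {rmorphism K -> K}).
Hypothesis dimK : \dim {:K} = 4%N.
Hypothesis theta_gen : generates theta.
Hypothesis tower_span : forall x, exists p q r t,
  x = f p + f q * eps + (f r + f t * eps) * theta.
Hypothesis tower_free : forall p q r t,
  f p + f q * eps + (f r + f t * eps) * theta = 0 ->
  [/\ p = 0, q = 0, r = 0 & t = 0].
Hypothesis theta_sqr : theta ^+ 2 = eps * theta + 1.
Hypothesis eps_sqr : eps ^+ 2 = m%:R * eps + 4.
Hypothesis sg_eps : sg eps = m%:R - eps.
Hypothesis sg2_theta : sg (sg theta) = eps - theta.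

Local Notation O := (@integers K).

Lemma eps_thetaE : eps = theta ^+ 3 - m%:R * theta ^+ 2 - 5 * theta + m%:R.
Proof.
have -> : theta ^+ 3 = (m%:R * eps + 5) * theta + eps.
  have -> : theta ^+ 3 = theta ^+ 2 * theta by ring.
  by rewrite theta_sqr; ring: theta_sqr eps_sqr.
by rewrite theta_sqr; ring.
Qed.

Lemma Zadjoin_eps : Zadjoin theta eps.
Proof. by rewrite eps_thetaE; zadjoin. Qed.

Let two_neq0 : (2 : K) != 0. Proof. exact: natr_K_neq0. Qed.

(* [omega = eps / 2] if [v(m) = 1], and [omega = (eps + 2) / 4] if [v(m) >= 3]. *)
Section FreeCase.
Variables (omega : K) (A B u w a u1 w1 u' : int) (Do N : nat).
Hypothesis omega_sqr : omega ^+ 2 = A%:~R * omega + B%:~R.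
Hypothesis sg_omega : sg omega = A%:~R - omega.
Hypothesis epsE : eps = u%:~R * omega + w%:~R.
Hypothesis quad_integers : forall p q, integers (f p + f q * omega) ->
  exists a b : int, p = a%:~R /\ q = b%:~R.
Hypothesis Do_gt0 : (0 < Do)%N.
Hypothesis Do_sqf : forall p, prime p -> ~ (p ^ 2 %| Do)%N.
Hypothesis DoE : A ^+ 2 + 4 * B = Do%:Z * 1%N%:Z.
Hypothesis uwE : u * A + 2 * w = m%:Z.
Hypothesis DeltaE : (m ^ 2 + 16)%N%:Z = u ^+ 2 * (A ^+ 2 + 4 * B).
Hypothesis uE8 : 8 * u * 1%N%:Z = 2 ^+ N.
Hypothesis A_odd : A = 2 * a + 1.
Hypothesis u_even : u = 2 * u1.
Hypothesis w_even : w = 2 * w1.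
Hypothesis u_dvd4 : u * u' = 4.

(** This is eps / 2, so that theta^2 = 2 la theta + 1. *)
Local Notation la := (u1%:~R * omega + w1%:~R).
Local Notation R := (quad_order omega).
Variables (U' z : K).
Hypotheses (OU' : O U') (Oz : O z).
Hypothesis UU' : (1 + (1 + la) * theta) * U' = 1 + 2 * z.

Let Oomega : O omega. Proof. exact: integers_omega omega_sqr. Qed.
Let Oeps : O eps. Proof. exact: integers_eps eps_sqr. Qed.
Let Otheta : O theta. Proof. exact: integers_theta theta_sqr eps_sqr. Qed.
Let theta2 : theta ^+ 2 = 2 * la * theta + 1.
Proof. by rewrite theta_sqr epsE u_even w_even; ring. Qed.

(** As [A] is odd, 2 is unramified in [R]: the omega coordinate of the square forces [y] to be even,
    and then the other one forces [x] to be even. *)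
Lemma free_half_sqr al : R al -> O (al ^+ 2 / 2) -> exists2 al', R al' & al = 2 * al'.
Proof.
move=> Ral Oal2.
have kal2 : quad_field f omega (al ^+ 2 / 2).
  apply: (quad_fieldM omega_sqr); first by apply/quad_field_order/(quad_orderM omega_sqr).
  exists (1 / 2), 0; rewrite rmorph0 mul0r addr0 fmorph_div rmorph1 rmorph_nat.
  by rewrite mul1r.
have [c [d cdE]] := quad_order_integers quad_integers kal2 Oal2.
move: Ral Oal2 kal2 cdE => [x [y ->]] _ _ cdE.
have [] := @quad_order_free K f theta eps omega u w tower_free epsE
  (x ^+ 2 + B * y ^+ 2 - 2 * c) (2 * x * y + A * y ^+ 2 - 2 * d).
  have -> : (x ^+ 2 + B * y ^+ 2 - 2 * c)%:~R + (2 * x * y + A * y ^+ 2 - 2 * d)%:~R * omega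
    = (x%:~R + y%:~R * omega) ^+ 2 - 2 * (c%:~R + d%:~R * omega) by ring: omega_sqr.
  by rewrite -cdE [2 * _]mulrC divfK // subrr.
have [x' [] ->] := int_parity x; have [y' [] ->] := int_parity y; rewrite A_odd => xy1 xy2;
  try by exfalso; lia.
by exists (x'%:~R + y'%:~R * omega); [exists x', y' | ring].
Qed.

(* [(theta + 1)^2 = 2 (1 + (1 + la) theta)], where [U'] inverts the second factor modulo [2]. *)
Lemma free_half_pi al : R al -> O (al * (theta + 1) / 2) ->
  exists2 al', R al' & al = 2 * al'.
Proof.
move=> Ral Oalp; apply: free_half_sqr => //.
have Oal := integers_quad_order omega_sqr Ral.
have : O ((al * (theta + 1) / 2) ^+ 2 * U' - al ^+ 2 * z) by ints.
congr integers.
have -> : (al * (theta + 1) / 2) ^+ 2 * U' =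
    al ^+ 2 * ((1 + (1 + la) * theta) * U') / 2.
  have -> : (al * (theta + 1) / 2) ^+ 2 = al ^+ 2 * (theta ^+ 2 + 2 * theta + 1) / 4.
    by field; rewrite ?natr_K_neq0.
  by rewrite theta2; field; rewrite ?natr_K_neq0.
by rewrite UU'; field; rewrite ?natr_K_neq0.
Qed.

Lemma free_integers y : O y -> exists al be, [/\ R al, R be & y = al + be * theta].
Proof.
move=> Oy; have [al [be [Ral Rbe yE]]] := two_power_denominator tower_span
   tower_free theta_sqr eps_sqr sg_eps sg2_theta omega_sqr sg_omega epsE quad_integers
   Do_gt0 Do_sqf DoE uwE DeltaE uE8 Oy.
apply: (@pow2_descent K (fun y => exists al be, [/\ R al, R be & y = al + be * theta]) N.+1) => //;
  last by exists al, be.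
move=> {al be Ral Rbe yE Oy}y Oy [al [be [Ral Rbe yE]]].
have Obe := integers_quad_order omega_sqr Rbe.
(* With pi = theta + 1, 2 y is al - be + be pi up to terms that already have this form. As pi^2 is
   twice an integer, multiplication by pi isolates al - be. *)
have [||al2 Ral2 al2E] := @free_half_pi (al - be).
- by apply: quad_orderD => //; apply: quad_orderN.
- have : O (y * (theta + 1) - be * (1 + (1 + la) * theta)) by ints.
  congr integers; apply: (mulIf two_neq0); rewrite divfK // mulrBl.
  have -> : y * (theta + 1) * 2 = (2 * y) * (theta + 1) by ring.
  by rewrite yE; ring: theta2.
have Oal2 := integers_quad_order omega_sqr Ral2.
have [|be2 Rbe2 be2E] := @free_half_pi be Rbe.
  have : O (y - al2) by ints.
  congr integers; apply: (mulIf two_neq0); rewrite divfK // mulrBl mulrC yE.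
  by rewrite [al2 * 2]mulrC -al2E; ring.
exists (al2 + be2), be2; split=> //; first exact: quad_orderD.
apply: (mulfI two_neq0); rewrite yE -[al](subrK be) al2E be2E; ring.
Qed.

Lemma free_basis :
  integral_basis (fun i : 'I_4 => [:: 1; omega; theta; omega * theta]`_i).
Proof.
apply: integral_basis4; ints.
  move=> x /free_integers[_ [_ [[a' [b ->]] [c [d ->]] ->]]].
  by exists a', b, c, d; ring.
move=> a' b c d abcd; apply: (tower_freeR tower_free epsE).
by rewrite -abcd; ring.
Qed.

Lemma free_common_index : common_index K 1.
Proof.
have Ob : O (omega + theta) by ints.
have Z4om : Zadjoin theta (4 * omega).
  have -> : 4 * omega = u'%:~R * (eps - w%:~R).
    by rewrite epsE addrK mulrA -rmorphM mulrC [u' * u]mulrC u_dvd4 mulrC.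
  by have Ze := Zadjoin_eps; zadjoin.
apply: (@common_index_eq1 K 4 _ free_basis theta (omega + theta) 2) => //.
  have Zt := Zadjoin_gen theta.
  move=> [[|[|[|[|]]]]] //= _; rewrite -[(2 ^ 2)%N%:R]/4%:R //; first by zadjoin.
  - by zadjoin.
  - by rewrite mulrA; zadjoin.
(* Modulo 2, (omega + theta)^2 is omega^2 + theta^2, that is omega + B + 1, since [A] is odd. *)
have mod2_om : Zadjoin_mod2 (omega + theta) omega.
  exists ((omega + theta) ^+ 2 - (B + 1)%:~R), (- (a%:~R * omega + (omega + la) * theta)).
  split; [zadjoin | ints |].
  rewrite rmorphD /=.
  have -> : (omega + theta) ^+ 2 = omega ^+ 2 + 2 * omega * theta + theta ^+ 2 by ring.
  by rewrite omega_sqr theta2 A_odd; ring.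
have mod2_b : Zadjoin_mod2 (omega + theta) (omega + theta).
  by apply/Zadjoin_mod2W/Zadjoin_gen.
have mod2_th : Zadjoin_mod2 (omega + theta) theta.
  have thE : theta = (omega + theta) - omega by ring.
  rewrite [X in Zadjoin_mod2 _ X]thE.
  exact: Zadjoin_mod2D mod2_b (Zadjoin_mod2N mod2_om).
move=> [[|[|[|[|]]]]] //= _; first by apply/Zadjoin_mod2W/Zadjoin1.
exact: Zadjoin_mod2M.
Qed.

Lemma free_ideal_sqr : ideal_exp (ideal2 2 (theta + 1)) 2 = ideal1 2.
Proof.
apply: (@ideal_exp_eq2 _ _ (1 + (1 + la) * theta) U' z) => //; ints.
by rewrite sqrrD theta2; ring.
Qed.

Lemma free_residue x : O x -> exists b c : int,
  ideal2 2 (theta + 1) (x - (b%:~R + c%:~R * omega)).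
Proof.
move=> /free_integers[_ [be [[b [c ->]] Rbe ->]]].
have Obe := integers_quad_order omega_sqr Rbe; case: Rbe => d [e beE].
exists (b - d), (c - e), 0, be; split; ints.
by rewrite beE; ring.
Qed.

(** With [A] and [B] odd, omega^2 + omega + 1 is 0 modulo 2, and the residue field is F_4. *)
Lemma free_prime : (exists b1, B = 2 * b1 + 1) ->
  is_prime_ideal (ideal2 2 (theta + 1)).
Proof.
move=> [b1 BE]; apply: (@prime_ideal_F4 _ _ omega) => //.
- by apply: is_ideal2; ints.
- by apply: (ideal_exp_proper _ free_ideal_sqr); ints.
- exact: ideal2_l.
- exists ((a + 1)%:~R * omega + (b1 + 1)%:~R), 0; split; ints.
  by rewrite omega_sqr A_odd BE; ring.
- exact: free_residue.
Qed.

Lemma free_even (c d : int) x : O x -> c%:~R + d%:~R * omega = 2 * x ->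
  exists c' d', c = 2 * c' /\ d = 2 * d'.
Proof.
move=> /free_integers[_ [_ [[a' [b ->]] [a2 [b2 ->]] ->]]] cdE.
have [] := tower_freeR tower_free epsE (a := c - 2 * a') (b := d - 2 * b)
  (c := - 2 * a2) (d := - 2 * b2).
  rewrite -[RHS](subrr (c%:~R + d%:~R * omega)) {2}cdE; ring.
by exists a', b; split; lia.
Qed.

(** With [A] odd and [B] even, b = omega + theta satisfies b (b + 1) = theta + 1 modulo 2. Hence
    [P1] and [P2] have product (2, theta + 1), whose square is generated by 2. *)
Lemma free_split : (exists b1, B = 2 * b1) ->
  let P1 := ideal2 2 (omega + theta) in
  let P2 := ideal2 2 (omega + theta + 1) in
  [/\ is_prime_ideal P1, is_prime_ideal P2, P1 <> P2 &
      ideal1 2 = ideal_mul (ideal_exp P1 2) (ideal_exp P2 2)].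
Proof.
move=> [b1 BE] P1 P2; set b := omega + theta in P1 P2 *.
have Ob : O b by rewrite /b; ints.
have idP1 : is_ideal P1 by apply: is_ideal2; ints.
have idP2 : is_ideal P2 by apply: is_ideal2; ints.
have idP0 : is_ideal (ideal2 2 (theta + 1)) by apply: is_ideal2; ints.
pose r := a%:~R * omega + b1%:~R + (omega + la) * theta.
have Or : O r by rewrite /r; ints.
have b2E : b ^+ 2 = omega + 1 + 2 * r.
  have -> : b ^+ 2 = omega ^+ 2 + 2 * omega * theta + theta ^+ 2 by rewrite /b; ring.
  by rewrite omega_sqr theta2 A_odd BE /r; ring.
have P12 : ideal_mul P1 P2 = ideal2 2 (theta + 1).
  have idP12 := is_ideal_mul idP1 idP2.
  apply/seteqP; split.
    apply: ideal_mul_sub => // _ _ [x [y [Ox Oy ->]]] [x' [y' [Ox' Oy' ->]]].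
    exists (x * (2 * x' + (b + 1) * y') + b * y * x' + (omega + r) * (y * y')), (y * y').
    split; ints.
    have -> : (2 * x + b * y) * (2 * x' + (b + 1) * y') =
       2 * (x * (2 * x' + (b + 1) * y') + b * y * x') + (b ^+ 2 + b) * (y * y') by ring.
    by rewrite b2E /b; ring.
  have M2 : ideal_mul P1 P2 2.
    have -> : 2 = 2 * (b + 1) - b * 2 by ring.
    apply: idealB => //; apply: mem_ideal_mul;
      by [exact: ideal2_l | exact: ideal2_r].
  apply: ideal2_sub => //.
  have -> : theta + 1 = b * (b + 1) - (omega + r) * 2.
    have -> : b * (b + 1) = b ^+ 2 + b by ring.
    by rewrite b2E /b; ring.
  apply: idealB => //; last by case: idP12 => _ _ _; apply; ints.
  by apply: mem_ideal_mul; apply: ideal2_r.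
have P0sqr x : ideal2 2 (theta + 1) x -> exists2 y, O y & x ^+ 2 = 2 * y.
  move=> P0x; have : ideal1 2 (x ^+ 2) by rewrite -free_ideal_sqr; apply: mem_ideal_exp.
  by case=> y Oy ->; exists y.
(* Otherwise [P2] would be (2, theta + 1), whose elements have squares divisible by 2; but (b + 1)^2
   is omega modulo 2. The same argument for [P2] uses b^2, which is omega + 1 modulo 2. *)
have P1_1 : ~ P1 1.
  move=> /(ideal_top idP1) P1O; move: P12; rewrite P1O ideal_mulC //; last exact: is_ideal_integers.
  rewrite ideal_mulO // => P20; have : P2 (b + 1) by apply: ideal2_r.
  rewrite P20 => /P0sqr[y Oy yE].
  have [||c [d [_ d2]]] := @free_even 0 1 (y - r - 1 - b); ints; last by lia.
  rewrite -[LHS](subrK (2 * (1 + r + b))); have := yE.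
  have -> : (b + 1) ^+ 2 = b ^+ 2 + 2 * b + 1 by ring.
  by rewrite b2E => yE2; rewrite mulrBr mulrBr mulrBr -yE2; ring.
have P2_1 : ~ P2 1.
  move=> /(ideal_top idP2) P2O; move: P12; rewrite P2O ideal_mulO // => P10.
  have : P1 b by apply: ideal2_r.
  rewrite P10 => /P0sqr[y Oy]; rewrite b2E => yE.
  have [||c [d [_ d2]]] := @free_even 1 1 (y - r); ints; last by lia.
  by rewrite mulrBr -yE; ring.
split.
- apply: prime_ideal_F2 => //; first exact: ideal2_l.
  move=> _ /free_integers[_ [_ [[c [d ->]] [e [g ->]] ->]]]; exists (c - d + e - g).
  (* Modulo [P1], omega is -1 and theta is 1. *)
  have P1o : P1 (omega + 1).
    exists (- r), b; split; ints.
    by rewrite -expr2 b2E; ring.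
  have -> : c%:~R + d%:~R * omega + (e%:~R + g%:~R * omega) * theta - (c - d + e - g)%:~R
     = (omega + 1) * (d%:~R + g%:~R * theta - (e%:~R - g%:~R)) + b * (e%:~R - g%:~R).
    by rewrite /b; ring.
  by apply: ideal_lin => //; ints; apply: ideal2_r.
- apply: prime_ideal_F2 => //; first exact: ideal2_l.
  move=> _ /free_integers[_ [_ [[c [d ->]] [e [g ->]] ->]]]; exists (c - e).
  (* Modulo [P2], omega is 0 and theta is -1. *)
  have P2o : P2 omega.
    exists (- (1 + r + b)), (b + 1); split; ints.
    have -> : 2 * - (1 + r + b) + (b + 1) * (b + 1) = b ^+ 2 - 2 * r - 1 by ring.
    by rewrite b2E; ring.
  have -> : c%:~R + d%:~R * omega + (e%:~R + g%:~R * omega) * theta - (c - e)%:~R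
     = omega * (d%:~R + g%:~R * theta - e%:~R) + (b + 1) * e%:~R.
    by rewrite /b; ring.
  by apply: ideal_lin => //; ints; apply: ideal2_r.
- move=> P1P2; apply: P1_1.
  have -> : 1 = (b + 1) - b by ring.
  by apply: idealB => //; [rewrite P1P2; apply: ideal2_r | apply: ideal2_r].
- by rewrite ideal_exp2M // P12 free_ideal_sqr.
Qed.

Lemma free_case : [/\ common_index K 1,
    ideal_exp (ideal2 2 (theta + 1)) 2 = ideal1 2,
    ((exists b1, B = 2 * b1 + 1) -> is_prime_ideal (ideal2 2 (theta + 1))) &
    ((exists b1, B = 2 * b1) ->
      let P1 := ideal2 2 (omega + theta) in
      let P2 := ideal2 2 (omega + theta + 1) in
      [/\ is_prime_ideal P1, is_prime_ideal P2, P1 <> P2 &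
          ideal1 2 = ideal_mul (ideal_exp P1 2) (ideal_exp P2 2)])].
Proof.
by split; [exact: free_common_index | exact: free_ideal_sqr | exact: free_prime
  | exact: free_split].
Qed.

End FreeCase.

(** * Odd m: the integers, the two primes over 2 and the common index 2 *)

Section OddCase.
Variable (h : int).
Hypothesis mE : m%:Z = 2 * h + 1.
Hypothesis Delta_sqf : forall p, prime p -> ~ (p ^ 2 %| m ^ 2 + 16)%N.

Local Notation R := (quad_order eps).
Local Notation rho := ((1 + eps) * (1 + theta) / 2).

Let Oeps : O eps. Proof. exact: integers_eps eps_sqr. Qed.
Let Otheta : O theta. Proof. exact: integers_theta theta_sqr eps_sqr. Qed.
Let mK : m%:R = 2 * h%:~R + 1 :> K.
Proof. by rewrite -[m%:R]/((m : int)%:~R) mE; ring. Qed.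
Let eps2 : eps ^+ 2 = m%:Z%:~R * eps + 4%:Z%:~R.
Proof. exact: eps_sqr. Qed.
Let sg_eps' : sg eps = m%:Z%:~R - eps. Proof. exact: sg_eps. Qed.
Let epsE : eps = 1%:~R * eps + 0%:~R. Proof. by ring. Qed.
Let rho2 : 2 * rho = (1 + eps) * (1 + theta).
Proof. by rewrite mulrC divfK. Qed.

Lemma odd_quad_integers p q : O (f p + f q * eps) ->
  exists a b : int, p = a%:~R /\ q = b%:~R.
Proof.
apply: (quad_integers_1 eps2 sg_eps' (D := (m ^ 2 + 16)%N)) => //.
Qed.

(** The coefficients are the trace and the norm of [rho] over Q(eps); they lie in Z[eps], which
    makes [rho] integral. *)
Lemma odd_rho_sqr : rho ^+ 2 = (3 + (h + 2)%:~R * eps) * rho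
  - (((h + 1) ^+ 2 + 1)%:~R * eps + (2 * h + 3)%:~R).
Proof.
have e2 : eps ^+ 2 = (2 * h%:~R + 1) * eps + 4 by rewrite eps_sqr mK.
apply: (mulfI (mulf_neq0 two_neq0 two_neq0)).
have -> : 2 * 2 * rho ^+ 2 = (2 * rho) ^+ 2 by ring.
have -> : 2 * 2 * ((3 + (h + 2)%:~R * eps) * rho - (((h + 1) ^+ 2 + 1)%:~R * eps + (2 * h + 3)%:~R)) =
   2 * (3 + (h + 2)%:~R * eps) * (2 * rho) - 4 * (((h + 1) ^+ 2 + 1)%:~R * eps + (2 * h + 3)%:~R) by ring.
by rewrite rho2; ring: theta_sqr e2.
Qed.

Let Orho : O rho.
Proof.
apply: (@integers_quadratic _ _ (3 + (h + 2)%:~R * eps)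
  (- (((h + 1) ^+ 2 + 1)%:~R * eps + (2 * h + 3)%:~R))); ints.
exact: odd_rho_sqr.
Qed.

Lemma odd_quad_even (c d : int) : O ((c%:~R + d%:~R * eps) / 2) ->
  exists c' d', c = 2 * c' /\ d = 2 * d'.
Proof.
have -> : (c%:~R + d%:~R * eps) / 2 = f (c%:~R / 2) + f (d%:~R / 2) * eps.
  by rewrite !fmorph_div !rmorph_int rmorph_nat; field; rewrite ?natr_K_neq0.
move=> /odd_quad_integers[c' [d' [cE dE]]]; exists c', d'.
by split; apply/eqP; rewrite -(@eqr_int rat) rmorphM /= -?cE -?dE mulrC divfK.
Qed.

(** In the descent from 2 y to y, the relative trace of [y] makes [c3] and [c1] even; what is left
    lies in Q(eps), whose integers are known. *)
Lemma odd_integers y : O y -> exists c0 c1 c2 c3 : int,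
  y = c0%:~R + c1%:~R * theta + c2%:~R * eps + c3%:~R * rho.
Proof.
move=> Oy.
have [|||||al [be [[a [b ->]] [c [d ->]] yE]]] := @two_power_denominator _ _ _ _ _ _ _ _ _ _ _
   tower_span tower_free theta_sqr eps_sqr sg_eps sg2_theta eps2 sg_eps' epsE odd_quad_integers
   (m ^ 2 + 16) 1 3 _ Delta_sqf _ _ _ _ y Oy.
- by rewrite addn_gt0 orbT.
- by rewrite PoszD PoszM; ring.
- by ring.
- by rewrite PoszD PoszM; ring.
- by [].
apply: (@pow2_descent K (fun y => exists c0 c1 c2 c3 : int,
  y = c0%:~R + c1%:~R * theta + c2%:~R * eps + c3%:~R * rho) 4) => //; last first.
  (* Here eps theta = 2 rho - 1 - eps - theta. *)
  exists (a - d), (c - d), (b - d), (2 * d).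
  have -> : (2 * d)%:~R * rho = d%:~R * (2 * rho) by ring.
  by rewrite yE rho2; ring.
move=> {al be yE}{}y {}Oy [c0 [c1 [c2 [c3 yE]]]].
pose al := f ((2 * c0 + c3)%:~R / 4) + f ((2 * c2 + c3)%:~R / 4) * eps.
pose be := f ((2 * c1 + c3)%:~R / 4) + f (c3%:~R / 4) * eps.
have four_neq0 : (4 : K) != 0 by exact: natr_K_neq0.
have alE : 4 * al = (2 * c0 + c3)%:~R + (2 * c2 + c3)%:~R * eps.
  by rewrite /al !fmorph_div !rmorph_int rmorph_nat; field.
have beE : 4 * be = (2 * c1 + c3)%:~R + c3%:~R * eps.
  by rewrite /be !fmorph_div !rmorph_int rmorph_nat; field.
have yE' : y = al + be * theta.
  apply: (mulfI four_neq0); rewrite mulrDr mulrA alE beE.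
  have -> : 4 * y = 2 * (2 * y) by ring.
  rewrite yE; have -> : 2 * (c0%:~R + c1%:~R * theta + c2%:~R * eps + c3%:~R * rho) =
    2 * (c0%:~R + c1%:~R * theta + c2%:~R * eps) + c3%:~R * (2 * rho) by ring.
  by rewrite rho2; ring.
have [] : R (2 * al + eps * be).
  apply: (relative_trace sg2_theta eps2 sg_eps' epsE odd_quad_integers).
  - by exists ((2 * c0 + c3)%:~R / 4), ((2 * c2 + c3)%:~R / 4).
  - by exists ((2 * c1 + c3)%:~R / 4), (c3%:~R / 4).
  - by rewrite -yE'.
move=> a' [b' abE].
have [] := quad_order_free tower_free epsE (a := 2 * c0 + 3 * c3 - 2 * a')
   (b := c1 + 2 * c2 + (h + 2) * c3 - 2 * b').
  apply: (mulfI two_neq0); rewrite mulr0.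
  have := congr1 (fun x => 4 * x) abE => /=.
  have -> : 4 * (2 * al + eps * be) = 2 * (4 * al) + eps * (4 * be) by ring.
  rewrite alE beE => /eqP; rewrite -subr_eq0 => /eqP <-.
  have e2 : eps ^+ 2 = (2 * h%:~R + 1) * eps + 4 by rewrite eps_sqr mK.
  by ring: e2.
move=> c03 c12.
have [c3' c3E] : exists c3', c3 = 2 * c3' by exists (a' - c0 - c3); lia.
have [c1' c1E] : exists c1', c1 = 2 * c1'.
  by exists (b' - c2 - (h + 2) * c3'); rewrite c3E in c12; lia.
have yE2 : y - c1'%:~R * theta - c3'%:~R * rho = (c0%:~R + c2%:~R * eps) / 2.
  apply: (mulfI two_neq0).
  have -> : 2 * (y - c1'%:~R * theta - c3'%:~R * rho) =
    2 * y - (2 * c1')%:~R * theta - (2 * c3')%:~R * rho by ring.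
  by rewrite yE -c1E -c3E [RHS]mulrC divfK //; ring.
have [|c0' [c2' [c0E c2E]]] := @odd_quad_even c0 c2.
  by rewrite -yE2; move: Orho; set r := rho => Or; ints.
exists c0', c1', c2', c3'; apply: (mulfI two_neq0).
by rewrite yE c0E c1E c2E c3E; ring.
Qed.

(** With [tau] in place of [rho], the matrix of the powers of [theta] becomes triangular with
    determinant 2. *)
Local Notation tau := ((1 + theta ^+ 3) / 2).

Let theta3 : theta ^+ 3 = (m%:R * eps + 5) * theta + eps.
Proof.
have -> : theta ^+ 3 = theta ^+ 2 * theta by ring.
by rewrite theta_sqr; ring: theta_sqr eps_sqr.
Qed.

Let tau2 : 2 * tau = 1 + theta ^+ 3. Proof. by rewrite mulrC divfK. Qed.

Let rho_tau : rho = tau - h%:~R * theta ^+ 2 - 2 * theta + h%:~R.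
Proof.
apply: (mulfI two_neq0); rewrite rho2 !(mulrDr, mulrN) tau2 theta3 theta_sqr mK.
by ring.
Qed.

Lemma odd_basis :
  integral_basis (fun i : 'I_4 => [:: 1; theta; theta ^+ 2; tau]`_i).
Proof.
have Otau : O tau.
  have -> : tau = rho + h%:~R * theta ^+ 2 + 2 * theta - h%:~R by rewrite rho_tau; ring.
  by move: Orho; set r := rho => Or; ints.
apply: integral_basis4; ints.
  move=> _ /odd_integers[c0 [c1 [c2 [c3 ->]]]].
  exists (c0 + c2 * (2 * h) + c3 * h), (c1 - 5 * c2 - 2 * c3),
    (- (c2 * (2 * h + 1)) - c3 * h), (2 * c2 + c3).
  have -> : (2 * c2 + c3)%:~R * tau = c2%:~R * (2 * tau) + c3%:~R * tau by ring.
  have e_th : eps = theta ^+ 3 - m%:R * theta ^+ 2 - 5 * theta + m%:R.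
    by rewrite theta3 theta_sqr; ring.
  by rewrite rho_tau {1}e_th tau2 mK; ring.
move=> a b c d abcd.
have [] := tower_freeR tower_free epsE (a := 2 * a + 2 * c + d) (b := d)
  (c := 2 * b + 5 * d) (d := 2 * c + m%:Z * d).
  have := congr1 (fun x => 2 * x) abcd; rewrite mulr0 => <-.
  have -> : 2 * (a%:~R * 1 + b%:~R * theta + c%:~R * theta ^+ 2 + d%:~R * tau) =
    2 * (a%:~R + b%:~R * theta + c%:~R * theta ^+ 2) + d%:~R * (2 * tau) by ring.
  by rewrite tau2 theta3 theta_sqr; ring.
by move=> + d0; rewrite d0 => *; split; lia.
Qed.

Local Notation Q0 := (ideal2 2 eps).
Local Notation Q1 := (ideal2 2 (eps - 1)).

Let idQ0 : is_ideal Q0. Proof. by apply: is_ideal2; ints. Qed.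
Let idQ1 : is_ideal Q1. Proof. by apply: is_ideal2; ints. Qed.

(** One inclusion is eps (eps - 1) = 2 (h eps + 2); the other holds because [Q0] and [Q1] are
    comaximal. *)
Lemma odd_ideal_mul : ideal_mul Q0 Q1 = ideal1 2.
Proof.
apply/seteqP; split.
  apply: ideal_mul_ind.
  - by exists 0; ints; rewrite mulr0.
  - by move=> _ _ [x Ox ->] [y Oy ->]; exists (x + y); ints; rewrite mulrDr.
  move=> _ _ [x [y [Ox Oy ->]]] [x' [y' [Ox' Oy' ->]]].
  exists (x * (2 * x' + (eps - 1) * y') + eps * y * x' + (h%:~R * eps + 2) * (y * y')).
    by ints.
  have e2 : eps ^+ 2 = (2 * h%:~R + 1) * eps + 4 by rewrite eps_sqr mK.
  by ring: e2.
have [_ _ QD QM] := is_ideal_mul idQ0 idQ1.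
move=> _ [x Ox ->]; rewrite mulrC; apply: QM => //.
have two : 2 = eps * 2 - 2 * (eps - 1) by ring.
rewrite [X in ideal_mul _ _ X]two.
by apply: idealB; [exact: is_ideal_mul idQ0 idQ1 | |]; apply: mem_ideal_mul;
  by [exact: ideal2_l | exact: ideal2_r].
Qed.

Let rho_res : Q0 (rho ^+ 2 + rho + 1).
Proof.
exists (2 * rho - h%:~R - 1), ((h + 2)%:~R * rho - ((h + 1) ^+ 2 + 1)%:~R).
by split; [move: Orho; set r := rho => Or; ints .. | rewrite odd_rho_sqr; ring].
Qed.

(** Modulo [Q0], eps is 0 and 2 rho = (1 + eps)(1 + theta), so theta is -1. *)
Lemma odd_residue0 x : O x -> exists b c : int, Q0 (x - (b%:~R + c%:~R * rho)).
Proof.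
move=> /odd_integers[c0 [c1 [c2 [c3 ->]]]]; exists (c0 - c1), c3.
exists (c1%:~R * rho), (c2%:~R - c1%:~R * (1 + theta)).
split; [by move: Orho; set r := rho => Or; ints | by ints |].
have -> : 2 * (c1%:~R * rho) = c1%:~R * (2 * rho) by ring.
by rewrite rho2; ring.
Qed.

Lemma odd_residue1 x : O x -> exists b c : int, Q1 (x - (b%:~R + c%:~R * theta)).
Proof.
move=> /odd_integers[c0 [c1 [c2 [c3 ->]]]].
exists (c0 + c2 + c3 * (h + 1)), (c1 + c3 * (h + 1)).
exists (c3%:~R * (1 + theta)), (c2%:~R + c3%:~R * ((h + 1)%:~R * (1 + theta) - rho)).
split; [by ints | by move: Orho; set r := rho => Or; ints |].
(* Since eps is 1 modulo [Q1], this identity gives rho = (h + 1)(1 + theta) there. *)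
have erho : eps * rho = ((h + 1)%:~R * eps + 2) * (1 + theta).
  apply: (mulfI two_neq0); rewrite mulrCA rho2.
  have e2 : eps ^+ 2 = (2 * h%:~R + 1) * eps + 4 by rewrite eps_sqr mK.
  by ring: e2.
have -> : 2 * (c3%:~R * (1 + theta)) + (eps - 1) * (c2%:~R + c3%:~R * ((h + 1)%:~R * (1 + theta) - rho))
  = 2 * (c3%:~R * (1 + theta)) + (eps - 1) * (c2%:~R + c3%:~R * (h + 1)%:~R * (1 + theta))
    + c3%:~R * rho - c3%:~R * (eps * rho) by ring.
by rewrite erho; ring.
Qed.

Let theta_res : Q1 (theta ^+ 2 + theta + 1).
Proof. by exists (1 + theta), theta; split; ints; rewrite theta_sqr; ring. Qed.

Lemma odd_prime0 : is_prime_ideal Q0.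
Proof.
apply: (@prime_ideal_F4 _ _ rho) => //.
(* Otherwise [Q1] would be generated by 2, and (eps - 1) / 2 would be integral. *)
- move=> /(ideal_top idQ0) Q0O; have := odd_ideal_mul; rewrite Q0O ideal_mulC //;
    last exact: is_ideal_integers.
  rewrite ideal_mulO // => Q1E; have : Q1 (eps - 1) by apply: ideal2_r.
  rewrite Q1E => -[x Ox xE]; have [|c [d [_ d2]]] := @odd_quad_even (- 1) 1; last by lia.
  have -> : ((-1)%:~R + 1%:~R * eps) / 2 = x; last by [].
  by apply: (mulfI two_neq0); rewrite -xE [LHS]mulrC divfK //; ring.
- exact: ideal2_l.
- exact: odd_residue0.
Qed.

Lemma odd_prime1 : is_prime_ideal Q1.
Proof.
apply: (@prime_ideal_F4 _ _ theta) => //.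
- move=> /(ideal_top idQ1) Q1O; have := odd_ideal_mul; rewrite Q1O ideal_mulO // => Q0E.
  have : Q0 eps by apply: ideal2_r.
  rewrite Q0E => -[x Ox xE]; have [|c [d [_ d2]]] := @odd_quad_even 0 1; last by lia.
  have -> : (0%:~R + 1%:~R * eps) / 2 = x; last by [].
  by apply: (mulfI two_neq0); rewrite -xE [LHS]mulrC divfK //; ring.
- exact: ideal2_l.
- exact: odd_residue1.
Qed.

Lemma odd_prime_neq : Q0 <> Q1.
Proof.
move=> Q01; case: odd_prime0 => _ Q0_1 _; apply: Q0_1.
have one : 1 = eps - (eps - 1) by ring.
rewrite [X in ideal2 _ _ X]one.
by apply: idealB => //; [apply: ideal2_r | rewrite Q01; apply: ideal2_r].
Qed.

(** In each factor of F_4 x F_4, [x] is a root of X (X + 1) or of X^2 + X + 1. If the two factors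
    agree, this quadratic serves; otherwise the product of X or X + 1 with X^2 + X + 1 does. *)
Lemma odd_monic_mod2 x : O x -> exists p : {poly int},
  [/\ p \is monic, (size p <= 4)%N & exists2 y, O y & (map_poly intr p).[x] = 2 * y].
Proof.
move=> Ox.
have monP (s : seq int) : last 0 s = 1 -> (size s <= 4)%N ->
    ideal1 2 (foldr (fun c z => z * x + c%:~R) 0 s) ->
  exists p : {poly int},
    [/\ p \is monic, (size p <= 4)%N & exists2 y, O y & (map_poly intr p).[x] = 2 * y].
  move=> s_last s_size [y Oy yE]; have PsE : Poly s = s :> seq int.
    by apply: (PolyK (c := 0)); rewrite s_last.
  exists (Poly s); split; rewrite ?PsE //; last by exists y; rewrite // horner_map_Poly.
  by rewrite monicE lead_coefE PsE nth_last s_last.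
have inter y : Q0 y -> Q1 y -> ideal1 2 y.
  move=> Q0y Q1y; rewrite -odd_ideal_mul.
  have yE : y = eps * y - y * (eps - 1) by ring.
  rewrite [X in ideal_mul _ _ X]yE.
  by apply: idealB; [exact: is_ideal_mul idQ0 idQ1 | |]; apply: mem_ideal_mul => //; apply: ideal2_r.
have prod y z : Q0 y -> Q1 z -> ideal1 2 (y * z).
  by move=> ? ?; rewrite -odd_ideal_mul; apply: mem_ideal_mul.
have Oxs : O (x ^+ 2 + x + 1) by ints.
have c0 := F4_quadratic idQ0 (ideal2_l _ _) Orho rho_res Ox (odd_residue0 Ox).
have c1 := F4_quadratic idQ1 (ideal2_l _ _) Otheta theta_res Ox (odd_residue1 Ox).
have [_ _ prime0] := odd_prime0; have [_ _ prime1] := odd_prime1.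
have Ox1 : O (x + 1) by ints.
have x2E : x ^+ 2 + x = x * (x + 1) by ring.
case: c0 c1 => q0 [] q1.
- apply: (monP [:: 0; 1; 1]) => //=.
  by have := inter _ q0 q1; congr (ideal1 2 _); ring.
- move: q0; rewrite x2E => /prime0[//|//||] q0.
  + apply: (monP [:: 0; 1; 1; 1]) => //=.
    by have := prod _ _ q0 q1; congr (ideal1 2 _); ring.
  + apply: (monP [:: 1; 2; 2; 1]) => //=.
    by have := prod _ _ q0 q1; congr (ideal1 2 _); ring.
- move: q1; rewrite x2E => /prime1[//|//||] q1.
  + apply: (monP [:: 0; 1; 1; 1]) => //=.
    by have := prod _ _ q0 q1; congr (ideal1 2 _); ring.
  + apply: (monP [:: 1; 2; 2; 1]) => //=.
    by have := prod _ _ q0 q1; congr (ideal1 2 _); ring.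
- apply: (monP [:: 1; 1; 1]) => //=.
  by have := inter _ q0 q1; congr (ideal1 2 _); ring.
Qed.

Lemma odd_common_index : common_index K 2.
Proof.
(* The last row expresses theta^3 = 2 tau - 1. *)
pose s : seq (seq int) := [:: [:: 1; 0; 0; 0]; [:: 0; 1; 0; 0]; [:: 0; 0; 1; 0]; [:: -1; 0; 0; 2]].
pose M : 'M[int]_4 := \matrix_(i, j) (nth [::] s i)`_j.
apply: (@common_index_eq2 K 4 _ odd_basis theta M) => //.
- move=> i; rewrite /lincomb !big_ord_recl big_ord0 !mxE /= /bump /=.
  case: i => [[|[|[|[|//]]]]] i_lt /=; try by ring.
  apply/eqP; rewrite -subr_eq0; apply/eqP.
  have -> : 2%:~R * tau = 1 + theta ^+ 3 by exact: tau2.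
  by ring.
- rewrite det_trig; last first.
    by apply/is_trig_mxP => -[[|[|[|[|//]]]] i_lt] [[|[|[|[|//]]]] j_lt]; rewrite mxE.
  by rewrite !big_ord_recl big_ord0 !mxE.
- exact: odd_monic_mod2.
Qed.

(** Here [s] is 2 eps - m or its opposite, so the generators are eps - h and h + 1 - eps in some
    order. The parity of [h] decides which is congruent to eps, and which to eps - 1, modulo 2 and
    up to sign. *)
Lemma odd_factorization (s : K) : s ^+ 2 = (m ^ 2 + 16)%:R ->
  let P1 := ideal2 2 ((1 + s) / 2) in
  let P2 := ideal2 2 ((1 - s) / 2) in
  [/\ is_prime_ideal P1, is_prime_ideal P2, P1 <> P2 & ideal1 2 = ideal_mul P1 P2].
Proof.
move=> s2 P1 P2.
suff [[-> ->]|[-> ->]] : (P1 = Q0 /\ P2 = Q1) \/ (P1 = Q1 /\ P2 = Q0).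
- split; [exact: odd_prime0 | exact: odd_prime1 | exact: odd_prime_neq |].
  by rewrite odd_ideal_mul.
- split; [exact: odd_prime1 | exact: odd_prime0 | by move/esym/odd_prime_neq |].
  by rewrite ideal_mulC // odd_ideal_mul.
have sE : (s == 2 * eps - m%:R) || (s == - (2 * eps - m%:R)).
  rewrite -eqf_sqr s2 natrD natrX; apply/eqP.
  by ring: eps_sqr.
have congQ (x y z : K) : O x -> O y -> O z -> x = y + 2 * z \/ x = - y + 2 * z ->
    ideal2 2 x = ideal2 2 y.
  move=> Ox Oy Oz xy; apply: ideal2_eq; ints; try exact: ideal2_l.
    by case: xy => ->; [exists z, 1 | exists z, (-1)]; split; ints; ring.
  by case: xy => ->; [exists (- z), 1 | exists z, (-1)]; split; ints; ring.
have [k hE] := int_parity h.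
have P1E : (1 + (2 * eps - m%:R)) / 2 = eps - h%:~R by rewrite mK; field; rewrite ?natr_K_neq0.
have P2E : (1 - (2 * eps - m%:R)) / 2 = h%:~R + 1 - eps by rewrite mK; field; rewrite ?natr_K_neq0.
have Q0' : (exists k, h = 2 * k) ->
  ideal2 2 (eps - h%:~R) = Q0 /\ ideal2 2 (h%:~R + 1 - eps) = Q1.
  move=> [l ->]; split.
    by apply: (@congQ _ _ (- l%:~R)); ints; left; ring.
  by apply: (@congQ _ _ l%:~R); ints; right; ring.
have Q1' : (exists k, h = 2 * k + 1) ->
  ideal2 2 (eps - h%:~R) = Q1 /\ ideal2 2 (h%:~R + 1 - eps) = Q0.
  move=> [l ->]; split.
    by apply: (@congQ _ _ (- l%:~R)); ints; left; ring.
  by apply: (@congQ _ _ (l%:~R + 1)); ints; right; ring.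
rewrite /P1 /P2; case/orP: sE => /eqP ->.
  rewrite P1E P2E; case: hE => hE; [left; apply: Q0' | right; apply: Q1']; by exists k.
rewrite opprK P1E P2E; case: hE => hE; [right | left].
  by have [|-> ->] := Q0'; first by exists k.
by have [|-> ->] := Q1'; first by exists k.
Qed.

End OddCase.

(** * Valuation 2: the integers and the totally ramified prime *)

Section RamifiedCase.
Variables (n Do : nat) (h d : int) (omega : K).
Hypothesis mE : m = (4 * n)%N.
Hypothesis nE : n%:Z = 2 * h + 1.
Hypothesis DoE : (n ^ 2 + 1)%N = (2 * Do)%N.
Hypothesis Do_odd : Do%:Z = 2 * d + 1.
Hypothesis Do_sqf : forall p, prime p -> ~ (p ^ 2 %| Do)%N.
Hypothesis n_sqf : forall p, prime p -> ~ (p ^ 2 %| n ^ 2 + 1)%N.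
Hypothesis eps_omega : eps = 2 * omega.

Let mK : m%:R = 4 * n%:R :> K. Proof. by rewrite mE natrM. Qed.
Let nK : n%:R = 2 * h%:~R + 1 :> K.
Proof. by rewrite -[n%:R]/((n : int)%:~R) nE; ring. Qed.

Let omega_sqr : omega ^+ 2 = 2 * n%:R * omega + 1.
Proof.
apply: (mulfI (_ : (4 : K) != 0)); first exact: natr_K_neq0.
have -> : 4 * omega ^+ 2 = eps ^+ 2 by rewrite eps_omega; ring.
by rewrite eps_sqr eps_omega mK; ring.
Qed.
Let omega2 : omega ^+ 2 = (2 * n%:Z)%:~R * omega + 1%:~R.
Proof. by rewrite omega_sqr; ring. Qed.
Let sg_omega : sg omega = (2 * n%:Z)%:~R - omega.
Proof.
apply: (mulfI two_neq0).
have <- : sg (2 * omega) = 2 * sg omega by rewrite rmorphM rmorph_nat.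
by rewrite -eps_omega sg_eps eps_omega mK; ring.
Qed.
Let epsE : eps = 2%:~R * omega + 0%:~R. Proof. by rewrite eps_omega; ring. Qed.
Let theta2 : theta ^+ 2 = 2 * omega * theta + 1.
Proof. by rewrite theta_sqr eps_omega. Qed.

Let Oomega : O omega. Proof. exact: integers_omega omega2. Qed.
Let Oeps : O eps. Proof. exact: integers_eps eps_sqr. Qed.
Let Otheta : O theta. Proof. exact: integers_theta theta_sqr eps_sqr. Qed.

Local Notation rho := ((1 + omega) * (1 + theta) / 2).
(** This is (1 + theta)(1 + theta^2) / 4, written so that its integrality follows from that of
    [rho]. *)
Local Notation b := (rho + (2 * n%:R * omega + 1) * theta).

Let rho2 : 2 * rho = (1 + omega) * (1 + theta).
Proof. by rewrite mulrC divfK. Qed.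

Let Orho : O rho.
Proof.
apply: (@integers_quadratic _ _ (2 + 2 * (n%:R + 1) * omega)
  (- (omega + (n%:R + 1) * (2 * n%:R * omega + 1)))); ints.
apply: (mulfI (_ : (4 : K) != 0)); first exact: natr_K_neq0.
have -> : 4 * rho ^+ 2 = (2 * rho) ^+ 2 by ring.
have -> : 4 * ((2 + 2 * (n%:R + 1) * omega) * rho
   + - (omega + (n%:R + 1) * (2 * n%:R * omega + 1))) =
  2 * (2 + 2 * (n%:R + 1) * omega) * (2 * rho)
   - 4 * (omega + (n%:R + 1) * (2 * n%:R * omega + 1)) by ring.
by rewrite rho2; ring: theta2 omega_sqr.
Qed.

Let Ob : O b. Proof. by move: Orho; set r := rho => Or; ints. Qed.

Let bE : 2 * b = (1 + theta) * (1 + omega * theta).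
Proof. by rewrite mulrDr rho2; ring: theta2 omega_sqr. Qed.

(* [z2] and [E] are the error terms in [b^2 = 1 + omega] and [b^3 = 1 + omega theta]
   modulo [2]; [uu] and [vv] are inverse to each other modulo [2]. *)
Local Notation z2 := ((1 + (1 + n%:R) * omega) * theta
  + h%:~R * omega * (1 + (1 + omega) * theta) * (1 + 2 * omega * theta)
  + (1 + omega) * omega * theta * (1 + (1 + omega) * theta)).

Let b2 : b ^+ 2 = 1 + omega + 2 * z2.
Proof.
apply: (mulfI (_ : (4 : K) != 0)); first exact: natr_K_neq0.
have -> : 4 * b ^+ 2 = (2 * b) ^+ 2 by ring.
have o2 : omega ^+ 2 = 2 * (2 * h%:~R + 1) * omega + 1 by rewrite omega_sqr nK.
by rewrite bE nK; ring: theta2 o2.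
Qed.

Let Oz2 : O z2. Proof. by ints. Qed.

Local Notation E := (theta + (h + 1)%:~R * omega * (1 + theta)
  + n%:R * omega * (1 + omega) * theta + b * z2).

Let OE : O E.
Proof. by move: Ob Oz2; set bb := b; set zz := z2 => *; ints. Qed.

Let b3 : b ^+ 3 = 1 + omega * theta + 2 * E.
Proof.
have -> : b ^+ 3 = b * b ^+ 2 by ring.
rewrite b2.
have -> : b * (1 + omega + 2 * z2) = (1 + omega) * b + 2 * (b * z2) by ring.
have -> : (1 + omega) * b = (1 + omega) ^+ 2 * (1 + theta) / 2
   + (1 + omega) * (2 * n%:R * omega + 1) * theta by field; rewrite ?natr_K_neq0.
have -> : (1 + omega) ^+ 2 * (1 + theta) / 2 = (1 + (1 + n%:R) * omega) * (1 + theta).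
  apply: (mulIf two_neq0); rewrite divfK //.
  by ring: omega_sqr.
rewrite nK; by ring.
Qed.

Local Notation uu := (Do%:R * omega ^+ 2 * theta ^+ 4 * (1 + (1 + omega) * theta) ^+ 2).
Local Notation vv := ((omega - 2 * n%:R) ^+ 2 * (theta - 2 * omega) ^+ 4
  * (1 - (1 + omega) * theta) ^+ 2).

(** The factor 2 comes from (1 + n omega)^2 = (n^2 + 1) omega^2 = 2 Do omega^2, where 1 + n omega is
    a factor of b^2. *)
Let b4 : b ^+ 4 = 2 * uu.
Proof.
have n2 : n%:R ^+ 2 + 1 = 2 * Do%:R :> K by rewrite -natrX -(natrD _ _ 1) DoE natrM.
have -> : 2 * uu = (2 * Do%:R) * omega ^+ 2 * theta ^+ 4 * (1 + (1 + omega) * theta) ^+ 2 by ring.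
rewrite -n2.
have bsq : b ^+ 2 = (1 + n%:R * omega) * (1 + (1 + omega) * theta) * theta ^+ 2.
  apply: (mulfI (_ : (4 : K) != 0)); first exact: natr_K_neq0.
  have -> : 4 * b ^+ 2 = (2 * b) ^+ 2 by ring.
  by rewrite bE; ring: theta2 omega_sqr.
have -> : b ^+ 4 = (b ^+ 2) ^+ 2 by ring.
rewrite bsq.
have nn : (1 + n%:R * omega) ^+ 2 = (n%:R ^+ 2 + 1) * omega ^+ 2 by ring: omega_sqr.
by rewrite -nn; ring.
Qed.

Local Notation ka := ((1 + (1 + n%:R) * omega) * theta ^+ 2).
Local Notation zz := (d%:~R + Do%:R * (2 * ka ^+ 2 - 2 * ka)).

(** [omega] and [theta] are units with inverses omega - 2 n and theta - 2 omega, the square of 1 +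
    omega is even, and [Do] is odd. *)
Let uv : uu * vv = 1 + 2 * zz.
Proof.
have o1 : omega * (omega - 2 * n%:R) = 1 by ring: omega_sqr.
have t1 : theta * (theta - 2 * omega) = 1 by ring: theta2.
have p1 : (1 + (1 + omega) * theta) * (1 - (1 + omega) * theta) = 1 - 2 * ka.
  have -> : (1 + (1 + omega) * theta) * (1 - (1 + omega) * theta) =
    1 - (1 + omega) ^+ 2 * theta ^+ 2 by ring.
  have -> : (1 + omega) ^+ 2 = 2 * (1 + (1 + n%:R) * omega) by ring: omega_sqr.
  by ring.
have -> : uu * vv = Do%:R * (omega * (omega - 2 * n%:R)) ^+ 2
  * (theta * (theta - 2 * omega)) ^+ 4
  * ((1 + (1 + omega) * theta) * (1 - (1 + omega) * theta)) ^+ 2.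
  by rewrite !exprMn; ring.
rewrite o1 t1 p1; set k := ka.
have -> : Do%:R = 2 * d%:~R + 1 :> K by rewrite -[Do%:R]/((Do : int)%:~R) Do_odd; ring.
by ring.
Qed.

Let Ouu : O uu. Proof. by ints. Qed.
Let Ovv : O vv. Proof. by ints. Qed.
Let Ozz : O zz. Proof. by ints. Qed.

Let theta_b : theta = 1 - b ^+ 2 - b ^+ 3 + 2 * (E + rho + z2).
Proof.
rewrite b2 b3; set e := E; set z := z2.
have -> : 1 - (1 + omega + 2 * z) - (1 + omega * theta + 2 * e) + 2 * (e + rho + z)
  = 2 * rho - omega - 1 - omega * theta by ring.
by rewrite rho2; ring.
Qed.

Let omega_theta_b : omega * theta = b ^+ 3 - 1 - 2 * E.
Proof. by rewrite b3; set e := E; ring. Qed.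

(** Change of coordinates modulo 2 to the powers of [b]; the descent, the residue field and the
    index all rest on it. *)
Lemma ramified_expand (x0 x1 x2 x3 : int) : exists2 e, O e &
  x0%:~R + x1%:~R * theta + x2%:~R * (omega * theta) + x3%:~R * rho =
  (x0 + x1 - x2 - x3)%:~R + x3%:~R * b + (x3 - x1)%:~R * b ^+ 2
    + (x2 + x3 - x1)%:~R * b ^+ 3 + 2 * e.
Proof.
pose e' := E + rho + z2.
have Oe' : O e' by rewrite /e'; move: OE Orho Oz2; set e1 := E; set r := rho; set z := z2 => *; ints.
exists (x1%:~R * e' - x2%:~R * E - x3%:~R * (e' + n%:R * (omega * theta))).
  by move: OE; set e1 := E => *; ints.
have key (t ot r bb e1 e2 : K) : r = bb - t - 2 * n%:R * ot ->
    t = 1 - bb ^+ 2 - bb ^+ 3 + 2 * e2 -> ot = bb ^+ 3 - 1 - 2 * e1 ->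
  x0%:~R + x1%:~R * t + x2%:~R * ot + x3%:~R * r =
  (x0 + x1 - x2 - x3)%:~R + x3%:~R * bb + (x3 - x1)%:~R * bb ^+ 2
    + (x2 + x3 - x1)%:~R * bb ^+ 3
    + 2 * (x1%:~R * e2 - x2%:~R * e1 - x3%:~R * (e2 + n%:R * ot)).
  by move=> -> -> ->; ring.
apply: key; [by ring | exact: theta_b | exact: omega_theta_b].
Qed.

Lemma ramified_quad_integers p q : O (f p + f q * omega) ->
  exists a b : int, p = a%:~R /\ q = b%:~R.
Proof.
apply: (quad_integers_2 omega2 sg_omega (A' := n%:Z) (D := (n ^ 2 + 1)%N)) => //.
by rewrite DoE; lia.
Qed.

Lemma ramified_integers y : O y -> exists x0 x1 x2 x3 : int,
  y = x0%:~R + x1%:~R * theta + x2%:~R * (omega * theta) + x3%:~R * rho.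
Proof.
move=> Oy.
have [|||||al [be [[a0 [b0 ->]] [c0 [d0 ->]] yE]]] := @two_power_denominator _ _ _ _ _ _ _ _ _ _ _
   tower_span tower_free theta_sqr eps_sqr sg_eps sg2_theta omega2 sg_omega epsE
   ramified_quad_integers Do 8 7 _ Do_sqf _ _ _ _ y Oy.
- by lia.
- by move: DoE; lia.
- by rewrite mE; lia.
- by rewrite mE; nia.
- by [].
apply: (@pow2_descent K (fun y => exists x0 x1 x2 x3 : int,
  y = x0%:~R + x1%:~R * theta + x2%:~R * (omega * theta) + x3%:~R * rho) 8) => //;
  last first.
  (* Here omega = 2 rho - 1 - theta - omega theta. *)
  exists (a0 - b0), (c0 - b0), (d0 - b0), (2 * b0).
  have -> : (2 * b0)%:~R * rho = b0%:~R * (2 * rho) by ring.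
  by rewrite yE rho2; ring.
move=> {al be yE}{}y {}Oy [x0 [x1 [x2 [x3 yE]]]].
have [e Oe eE] := ramified_expand x0 x1 x2 x3.
have [||d0' [d1 [d2 [d3 [e0 e1 e2 e3]]]]] := ramified_chain Ob Ouu Ovv Ozz b4 uv
  (c0 := x0 + x1 - x2 - x3) (c1 := x3) (c2 := x3 - x1) (c3 := x2 + x3 - x1) (y := y - e).
- by ints.
- by rewrite mulrBr yE eE addrK.
(* The halves of [x0], ..., [x3], from inverting the unimodular change of coordinates. *)
exists (d0' + d3), (d1 - d2), (d3 - d2), d1.
apply: (mulfI two_neq0); rewrite yE.
have -> : x3 = 2 * d1 by [].
have -> : x1 = 2 * (d1 - d2) by lia.
have -> : x2 = 2 * (d3 - d2) by lia.
have -> : x0 = 2 * (d0' + d3) by lia.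
by ring.
Qed.

Lemma ramified_basis :
  integral_basis (fun i : 'I_4 => [:: 1; theta; omega * theta; rho]`_i).
Proof.
apply: integral_basis4; ints.
  by move=> x /ramified_integers[x0 [x1 [x2 [x3 ->]]]]; exists x0, x1, x2, x3; ring.
move=> x0 x1 x2 x3 xE.
have [] := tower_freeR tower_free epsE (a := 2 * x0 + x3) (b := x3)
  (c := 2 * x1 + x3) (d := 2 * x2 + x3).
  have := congr1 (fun x => 2 * x) xE; rewrite mulr0 => <-.
  have -> : 2 * (x0%:~R * 1 + x1%:~R * theta + x2%:~R * (omega * theta) + x3%:~R * rho) =
    2 * (x0%:~R + x1%:~R * theta + x2%:~R * (omega * theta)) + x3%:~R * (2 * rho) by ring.
  by rewrite rho2; ring.
by move=> *; split; lia.
Qed.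

Lemma ramified_ideal_exp : ideal_exp (ideal2 2 b) 4 = ideal1 2.
Proof. exact: (ideal_exp_eq2 Ob Ouu Ovv Ozz _ b4 uv). Qed.

Lemma ramified_prime : is_prime_ideal (ideal2 2 b).
Proof.
apply: prime_ideal_F2.
- by apply: is_ideal2 => //; ints.
- exact: (ideal_exp_proper Ob ramified_ideal_exp).
- exact: ideal2_l.
- move=> _ /ramified_integers[x0 [x1 [x2 [x3 ->]]]].
  have [e Oe ->] := ramified_expand x0 x1 x2 x3; exists (x0 + x1 - x2 - x3).
  move: Ob; set bb := b => Obb.
  exists e, (x3%:~R + (x3 - x1)%:~R * bb + (x2 + x3 - x1)%:~R * bb ^+ 2).
  by split; ints; ring.
Qed.

Lemma ramified_common_index : common_index K 1.
Proof.
have Zeps := Zadjoin_eps; have Zt := Zadjoin_gen theta.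
apply: (@common_index_eq1 K 4 _ ramified_basis theta b 2) => //.
  move=> [[|[|[|[|]]]]] //= _; rewrite -[(2 ^ 2)%N%:R]/4%:R //.
  - by zadjoin.
  - by zadjoin.
  - have -> : 4 * (omega * theta) = 2 * eps * theta by rewrite eps_omega; ring.
    by zadjoin.
  - have -> : 4 * rho = (2 + eps) * (1 + theta).
      have -> : 4 * rho = 2 * (2 * rho) by ring.
      by rewrite rho2 eps_omega; ring.
    by zadjoin.
have expand (x0 x1 x2 x3 : int) : Zadjoin_mod2 b
    (x0%:~R + x1%:~R * theta + x2%:~R * (omega * theta) + x3%:~R * rho).
  have [e Oe ->] := ramified_expand x0 x1 x2 x3.
  by eexists _, e; split; [|exact: Oe | reflexivity]; move: b => bb; zadjoin.
move=> [[|[|[|[|]]]]] //= _.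
- by have := expand 1 0 0 0; congr (Zadjoin_mod2 _ _); ring.
- by have := expand 0 1 0 0; congr (Zadjoin_mod2 _ _); ring.
- by have := expand 0 0 1 0; congr (Zadjoin_mod2 _ _); ring.
- by have := expand 0 0 0 1; congr (Zadjoin_mod2 _ _); ring.
Qed.

End RamifiedCase.

(** * Even m: the prescribed generators, according to the valuation *)

Lemma valuation1_case (n : nat) : m = (2 * n)%N -> odd n ->
    (forall p, prime p -> ~ (p ^ 2 %| n ^ 2 + 4)%N) ->
  let P := ideal2 2 ((m%:R * theta ^+ 3 + 10 * theta ^+ 2 - m%:R * theta + 6) / 4) in
  [/\ common_index K 1, is_prime_ideal P & ideal1 2 = ideal_exp P 2].
Proof.
move=> mE n_odd n_sqf P.
have four_neq0 : (4 : K) != 0 by exact: natr_K_neq0.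
have mK : m%:R = 2 * n%:R :> K by rewrite mE natrM.
have [omega eps_omega] : exists omega, eps = 2 * omega.
  by exists (eps / 2); rewrite mulrC divfK.
have [a nE] : exists a : int, n%:Z = 2 * a + 1 by exists n./2%:Z; lia.
have nK : n%:R = 2 * a%:~R + 1 :> K by rewrite -[n%:R]/((n : int)%:~R) nE; ring.
have omega_sqr : omega ^+ 2 = n%:Z%:~R * omega + 1%:~R.
  apply: (mulfI four_neq0).
  have -> : 4 * omega ^+ 2 = eps ^+ 2 by rewrite eps_omega; ring.
  by rewrite eps_sqr eps_omega mK; ring.
have sg_omega : sg omega = n%:Z%:~R - omega.
  apply: (mulfI two_neq0).
  have <- : sg (2 * omega) = 2 * sg omega by rewrite rmorphM rmorph_nat.
  by rewrite -eps_omega sg_eps eps_omega mK; ring.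
have epsE : eps = 2%:~R * omega + 0%:~R by rewrite eps_omega; ring.
have Oomega := integers_omega omega_sqr.
have Otheta := integers_theta theta_sqr eps_sqr.
have DE : n%:Z ^+ 2 + 4 * 1 = (n ^ 2 + 4)%N%:Z by lia.
have quad_int p q : O (f p + f q * omega) -> exists a b : int, p = a%:~R /\ q = b%:~R.
  by move=> Opq; apply: (quad_integers_1 omega_sqr sg_omega DE n_sqf Opq).
have omega2 : omega ^+ 2 = (2 * a%:~R + 1) * omega + 1 by rewrite omega_sqr nE; ring.
have theta2 : theta ^+ 2 = 2 * omega * theta + 1 by rewrite theta_sqr eps_omega.
(* Modulo 2, 1 + (1 + omega) theta has square omega^2, and omega^3 = 1 as [n] is odd; this gives its
   inverse. *)
have [||||||||||||U1 sqr prim _] := @free_case omega n%:Z 1 2 0 a 1 0 2 (n ^ 2 + 4) 4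
  omega_sqr sg_omega epsE quad_int _ n_sqf _ _ _ _ _ _ _ _
  ((1 + (1 + omega) * theta) * omega)
  ((2 * a ^+ 2 + 4 * a + 3)%:~R * omega + (a + 1)%:~R
    + ((1 + omega) + (1 + omega) ^+ 2 * omega) * omega * theta).
- by rewrite addn_gt0 orbT.
- by rewrite DE mulr1.
- by rewrite mE; lia.
- by rewrite mE; nia.
- by [].
- by [].
- by [].
- by [].
- by [].
- by ints.
- by ints.
- by ring: theta2 omega2.
(* The generator is omega (theta + 1) modulo 2, and [omega] is a unit with inverse omega - n. *)
have PE : P = ideal2 2 (theta + 1).
  pose t := n%:R * omega ^+ 2 * theta + 2 * omega * theta + a%:~R * omega + 2.
  have Ot : O t by rewrite /t; ints.
  have gE : (m%:R * theta ^+ 3 + 10 * theta ^+ 2 - m%:R * theta + 6) / 4 =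
      omega * (theta + 1) + 2 * t.
    apply: (mulIf four_neq0); rewrite divfK // /t mK nK.
    by ring: theta2 omega2.
  rewrite /P gE; apply: ideal2_eq; ints; try exact: ideal2_l.
  - by exists t, omega; split; ints; ring.
  - have om_inv : (omega - n%:R) * omega = 1 by rewrite nK; ring: omega2.
    exists (- ((omega - n%:R) * t)), (omega - n%:R); split; ints.
    have -> : 2 * - ((omega - n%:R) * t) + (omega * (theta + 1) + 2 * t) * (omega - n%:R)
      = ((omega - n%:R) * omega) * (theta + 1) by ring.
    by rewrite om_inv mul1r.
by rewrite PE; split=> //; apply: prim; exists 0.
Qed.

Lemma valuation3_case (n : nat) : m = (8 * n)%N ->
    (forall p, prime p -> ~ (p ^ 2 %| 4 * n ^ 2 + 1)%N) ->
  [/\ common_index K 1,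
   odd n ->
      let P := ideal2 2
        (((m%:R ^+ 3 + 25 * m%:R + 8) * theta ^+ 3
          + (5 * m%:R ^+ 2 + 168) * theta ^+ 2
          - (m%:R ^+ 3 + 21 * m%:R - 56) * theta
          - m%:R ^+ 2 + 8) / 16) in
      is_prime_ideal P /\ ideal1 2 = ideal_exp P 2 &
   ~~ odd n ->
      let P1 := ideal2 2 ((2 + 7 * theta + theta ^+ 3) / 4) in
      let P2 := ideal2 2 ((6 + 7 * theta + theta ^+ 3) / 4) in
      [/\ is_prime_ideal P1, is_prime_ideal P2, P1 <> P2 &
          ideal1 2 = ideal_mul (ideal_exp P1 2) (ideal_exp P2 2)]].
Proof.
move=> mE n_sqf.
have four_neq0 : (4 : K) != 0 by exact: natr_K_neq0.
have mK : m%:R = 8 * n%:R :> K by rewrite mE natrM.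
have [omega eps_omega] : exists omega, eps = 4 * omega - 2.
  by exists ((eps + 2) / 4); rewrite [4 * _]mulrC divfK // addrK.
have om2 : omega ^+ 2 = (1 + 2 * n%:R) * omega - n%:R.
  apply: (mulfI (_ : (16 : K) != 0)); first exact: natr_K_neq0.
  have -> : 16 * omega ^+ 2 = eps ^+ 2 + 4 * eps + 4 by rewrite eps_omega; ring.
  by rewrite eps_sqr eps_omega mK; ring.
have omega_sqr : omega ^+ 2 = (1 + 2 * n%:Z)%:~R * omega + (- n%:Z)%:~R.
  by rewrite om2; ring.
have sg_omega : sg omega = (1 + 2 * n%:Z)%:~R - omega.
  apply: (mulfI four_neq0); apply: (addIr (- 2)).
  have <- : sg (4 * omega - 2) = 4 * sg omega - 2.
    by rewrite rmorphB rmorphM !rmorph_nat.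
  by rewrite -eps_omega sg_eps eps_omega mK; ring.
have epsE : eps = 4%:~R * omega + (-2)%:~R by rewrite eps_omega; ring.
have Oomega := integers_omega omega_sqr.
have Otheta := integers_theta theta_sqr eps_sqr.
have DE : (1 + 2 * n%:Z) ^+ 2 + 4 * - n%:Z = (4 * n ^ 2 + 1)%N%:Z by lia.
have quad_int p q : O (f p + f q * omega) -> exists a b : int, p = a%:~R /\ q = b%:~R.
  by move=> Opq; apply: (quad_integers_1 omega_sqr sg_omega DE n_sqf Opq).
have theta2 : theta ^+ 2 = 2 * (2 * omega - 1) * theta + 1.
  by rewrite theta_sqr eps_omega; ring.
(* Here la = 2 omega - 1, so 1 + (1 + la) theta is already 1 modulo 2. As B = -n, the parity of [n]
   separates the inert and the split behaviour of 2 in the middle field. *)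
have [||||||||||||U1 sqr prim split] := @free_case omega (1 + 2 * n%:Z) (- n%:Z) 4 (-2) n%:Z 2 (-1) 1
  (4 * n ^ 2 + 1) 5
  omega_sqr sg_omega epsE quad_int _ n_sqf _ _ _ _ _ _ _ _ 1 (omega * theta).
- by rewrite addn_gt0 orbT.
- by rewrite DE mulr1.
- by rewrite mE; lia.
- by rewrite mE; nia.
- by [].
- by rewrite addrC.
- by [].
- by [].
- by [].
- by ints.
- by ints.
- by ring.
pose r := (1 + 2 * n%:R * (2 * omega - 1)) * theta.
have Or : O r by rewrite /r; ints.
have bE : (2 + 7 * theta + theta ^+ 3) / 4 = omega + theta + 2 * r.
  apply: (mulIf four_neq0); rewrite divfK // /r.
  by ring: theta2 om2.
split=> // n_par.
  have [k nE] : exists k : int, n%:Z = 2 * k + 1 by exists n./2%:Z; lia.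
  have nK : n%:R = 2 * k%:~R + 1 :> K by rewrite -[n%:R]/((n : int)%:~R) nE; ring.
  (* For b = omega + theta + 2 r and odd [n], b^2 + b + 1 is theta + 1 modulo 2. *)
  move=> P; have PE : P = ideal2 2 (theta + 1).
    pose t := (1 + n%:R) * omega - k%:~R + omega * theta + (2 * omega - 1) * theta
      + 2 * r * (omega + theta) + 2 * r ^+ 2 + r.
    have Ot : O t by rewrite /t; ints.
    have gE : ((m%:R ^+ 3 + 25 * m%:R + 8) * theta ^+ 3
          + (5 * m%:R ^+ 2 + 168) * theta ^+ 2
          - (m%:R ^+ 3 + 21 * m%:R - 56) * theta
          - m%:R ^+ 2 + 8) / 16 = (theta + 1) + 2 * t.
      apply: (mulIf (_ : (16 : K) != 0)); first exact: natr_K_neq0.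
      rewrite divfK; last exact: natr_K_neq0.
      have om2' : omega ^+ 2 = (1 + 2 * (2 * k%:~R + 1)) * omega - (2 * k%:~R + 1).
        by rewrite om2 nK.
      by rewrite /t /r mK nK; ring: theta2 om2'.
    rewrite /P gE; apply: ideal2_eq; ints; try exact: ideal2_l.
    - by exists t, 1; split; ints; ring.
    - by exists (- t), 1; split; ints; ring.
  rewrite PE; split=> //; apply: prim; exists (- k - 1); rewrite nE; ring.
have congr2 x : O x -> ideal2 2 (x + 2 * r) = ideal2 2 x.
  move=> Ox; apply: ideal2_eq; ints; try exact: ideal2_l.
  - by exists r, 1; split; ints; ring.
  - by exists (- r), 1; split; ints; ring.
have P2E : (6 + 7 * theta + theta ^+ 3) / 4 = omega + theta + 1 + 2 * r.
  have -> : (6 + 7 * theta + theta ^+ 3) / 4 = (2 + 7 * theta + theta ^+ 3) / 4 + 1.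
    by field; rewrite ?natr_K_neq0.
  by rewrite bE; ring.
rewrite bE P2E !congr2; ints.
apply: split; exists (- n./2%:Z); lia.
Qed.

Lemma valuation2_case (n : nat) : m = (4 * n)%N -> odd n ->
    (forall p, prime p -> ~ (p ^ 2 %| n ^ 2 + 1)%N) ->
  let P := ideal2 2 ((1 + theta + theta ^+ 2 + theta ^+ 3) / 4) in
  [/\ common_index K 1, is_prime_ideal P & ideal1 2 = ideal_exp P 4].
Proof.
move=> mE n_odd n_sqf P.
have four_neq0 : (4 : K) != 0 by exact: natr_K_neq0.
have [omega eps_omega] : exists omega, eps = 2 * omega.
  by exists (eps / 2); rewrite mulrC divfK.
have [h nE] : exists h : int, n%:Z = 2 * h + 1 by exists n./2%:Z; lia.
(* As [n] is odd, n^2 + 1 is twice an odd number, which plays the role of [Do]. *)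
have [d n2E] : exists d, (n ^ 2 + 1 = 2 * (2 * d + 1))%N.
  by exists (n./2 * n./2.+1)%N; have := odd_double_half n; rewrite n_odd; nia.
have d_sqf p : prime p -> ~ (p ^ 2 %| 2 * d + 1)%N.
  by move=> p_pr pd; apply: (n_sqf p p_pr); rewrite n2E dvdn_mull.
have dE : (2 * d + 1)%N%:Z = 2 * d%:Z + 1 by lia.
have PE : P = ideal2 2 ((1 + omega) * (1 + theta) / 2 + (2 * n%:R * omega + 1) * theta).
  congr (ideal2 2 _); apply: (mulIf four_neq0); rewrite divfK //.
  have mK : m%:R = 4 * n%:R :> K by rewrite mE natrM.
  have omega_sqr : omega ^+ 2 = 2 * n%:R * omega + 1.
    apply: (mulfI four_neq0).
    have -> : 4 * omega ^+ 2 = eps ^+ 2 by rewrite eps_omega; ring.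
    by rewrite eps_sqr eps_omega mK; ring.
  have theta2 : theta ^+ 2 = 2 * omega * theta + 1 by rewrite theta_sqr eps_omega.
  have -> : ((1 + omega) * (1 + theta) / 2 + (2 * n%:R * omega + 1) * theta) * 4 =
    2 * (1 + omega) * (1 + theta) + 4 * (2 * n%:R * omega + 1) * theta.
    by field; rewrite ?natr_K_neq0.
  by ring: theta2 omega_sqr.
rewrite PE; split.
- by apply: ramified_common_index; eassumption.
- by apply: ramified_prime; eassumption.
- by apply/esym; apply: ramified_ideal_exp; eassumption.
Qed.

End Cases.

(** * Reduction of the theorem to the local cases *)

Lemma squarefree_cofactor (m D c : nat) :
    (forall p, prime p -> odd p -> ~ (p ^ 2 %| m ^ 2 + 16)%N) ->
    (m ^ 2 + 16 = c * D)%N -> ~~ (4 %| D)%N ->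
  forall p, prime p -> ~ (p ^ 2 %| D)%N.
Proof.
move=> m_sqf mE D4 p p_pr pD; have [p2|p_odd] := even_prime p_pr.
  by rewrite p2 in pD; rewrite pD in D4.
by apply: (m_sqf p) => //; rewrite mE dvdn_mull.
Qed.

Theorem theorem1 (m : nat) (K : fieldExtType rat) (theta : K)
    (m_gt0 : (0 < m)%N) (m_neq3 : m <> 3%N)
    (m_sqf : forall p : nat, prime p -> odd p -> ~ (p ^ 2 %| m ^ 2 + 16)%N)
    (theta_root : root (map_poly (in_alg K) (simplest_quartic m)) theta)
    (theta_gen : generates theta) :
  [/\ (odd m -> common_index K 2) /\ (~~ odd m -> common_index K 1),
      (odd m ->
         (exists s : K, s ^+ 2 = (m ^ 2 + 16)%:R) /\
         (forall s : K, s ^+ 2 = (m ^ 2 + 16)%:R ->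
            let P1 := ideal2 2 ((1 + s) / 2) in
            let P2 := ideal2 2 ((1 - s) / 2) in
            [/\ is_prime_ideal P1, is_prime_ideal P2, P1 <> P2 &
                ideal1 2 = ideal_mul P1 P2])) &
      [/\ (logn 2 m = 1%N ->
             let P := ideal2 2 ((m%:R * theta ^+ 3 + 10 * theta ^+ 2
                                 - m%:R * theta + 6) / 4) in
             is_prime_ideal P /\ ideal1 2 = ideal_exp P 2),
          (logn 2 m = 2%N ->
             let P := ideal2 2 ((1 + theta + theta ^+ 2 + theta ^+ 3) / 4) in
             is_prime_ideal P /\ ideal1 2 = ideal_exp P 4),
          (logn 2 m = 3%N ->
             let P := ideal2 2
               (((m%:R ^+ 3 + 25 * m%:R + 8) * theta ^+ 3
                 + (5 * m%:R ^+ 2 + 168) * theta ^+ 2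
                 - (m%:R ^+ 3 + 21 * m%:R - 56) * theta
                 - m%:R ^+ 2 + 8) / 16) in
             is_prime_ideal P /\ ideal1 2 = ideal_exp P 2) &
          ((4 <= logn 2 m)%N ->
             let P1 := ideal2 2 ((2 + 7 * theta + theta ^+ 3) / 4) in
             let P2 := ideal2 2 ((6 + 7 * theta + theta ^+ 3) / 4) in
             [/\ is_prime_ideal P1, is_prime_ideal P2, P1 <> P2 &
                 ideal1 2 = ideal_mul (ideal_exp P1 2) (ideal_exp P2 2)])]].
Proof.
have [eps [theta_sqr eps_sqr epsE]] : exists eps, [/\ theta ^+ 2 = eps * theta + 1,
    eps ^+ 2 = m%:R * eps + 4 & eps * theta = theta ^+ 2 - 1].
  exists (theta - theta^-1); split; [exact: theta_sqr theta_root | exact: eps_sqr |].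
  by field; exact: theta_neq0 theta_root.
have [f fE] : exists f : {rmorphism rat -> K}, forall q, f q = in_alg K q.
  by exists (in_alg K).
have span := tower_span theta_gen theta_sqr eps_sqr fE.
have free := tower_free m_gt0 m_neq3 theta_sqr eps_sqr (f := f).
have dimK := dim_quartic m_gt0 m_neq3 theta_gen theta_sqr eps_sqr fE theta_root.
have [sg sgE] := quartic_automorphism m_gt0 m_neq3 theta_gen theta_sqr eps_sqr fE theta_root.
have not_rat (q : rat) : theta <> f q.
  have := theta_not_quadratic m_gt0 m_neq3 theta_sqr eps_sqr (f := f) (u := q) (v := 0).
  by rewrite rmorph0 mul0r addr0.
have t0 : theta != 0 by apply: theta_neq0 theta_root.
have t1 : theta - 1 != 0.
  by rewrite subr_eq0; apply/eqP => t1; apply: (not_rat 1); rewrite rmorph1.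
have t2 : theta + 1 != 0.
  by rewrite addr_eq0; apply/eqP => t2; apply: (not_rat (-1)); rewrite rmorphN1.
have two_neq0 : (2 : K) != 0 by exact: natr_K_neq0.
(* Applying [sg] to eps = (theta^2 - 1) / theta gives -4 / eps, which is m - eps. *)
have sg_eps : sg eps = m%:R - eps.
  have sgt0 : sg theta != 0 by rewrite fmorph_eq0.
  apply: (mulIf sgt0); rewrite -rmorphM epsE rmorphB rmorphXn rmorph1 sgE.
  apply: (mulIf (expf_neq0 2 t2)).
  have -> : (m%:R - eps) * ((theta - 1) / (theta + 1)) * (theta + 1) ^+ 2 =
    (m%:R - eps) * (theta ^+ 2 - 1) by field.
  rewrite -epsE.
  have -> : (m%:R - eps) * (eps * theta) = - 4 * theta by ring: eps_sqr.
  by field.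
(* The square of the automorphism sends theta to -1 / theta = eps - theta. *)
have sg2_theta : sg (sg theta) = eps - theta.
  rewrite sgE fmorph_div rmorphB rmorphD rmorph1 sgE.
  apply: (mulIf t0); rewrite [RHS]mulrBl epsE -expr2.
  field; rewrite t2 /=.
  have -> : theta - 1 + (theta + 1) = 2 * theta by ring.
  by rewrite mulf_neq0.
have val0 : odd m -> forall p, prime p -> ~ (p ^ 2 %| m ^ 2 + 16)%N.
  move=> m_odd; apply: (squarefree_cofactor m_sqf (c := 1)); first by rewrite mul1n.
  by have := odd_double_half m; rewrite m_odd; nia.
have [n cop_n mE] := pfactor_coprime (isT : prime 2) m_gt0.
have n_odd : odd n by rewrite -coprime2n.
have n2E := odd_double_half n; rewrite n_odd in n2E.
(* In the three even cases m^2 + 16 is 4 (n^2 + 4), 16 (n^2 + 1) and 16 (4 n^2 + 1), and 4 does not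
   divide the cofactor. *)
have case1 : logn 2 m = 1%N -> exists n, [/\ m = (2 * n)%N, odd n &
    forall p, prime p -> ~ (p ^ 2 %| n ^ 2 + 4)%N].
  move=> m1; exists n; have mE2 : m = (2 * n)%N by rewrite mE m1 mulnC.
  by split=> //; apply: (squarefree_cofactor m_sqf (c := 4)); rewrite ?mE2; nia.
have case2 : logn 2 m = 2%N -> exists n, [/\ m = (4 * n)%N, odd n &
    forall p, prime p -> ~ (p ^ 2 %| n ^ 2 + 1)%N].
  move=> m2; exists n; have mE2 : m = (4 * n)%N by rewrite mE m2 mulnC.
  by split=> //; apply: (squarefree_cofactor m_sqf (c := 16)); rewrite ?mE2; nia.
have case3 : (3 <= logn 2 m)%N -> exists n, [/\ m = (8 * n)%N, odd n = (logn 2 m == 3) &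
    forall p, prime p -> ~ (p ^ 2 %| 4 * n ^ 2 + 1)%N].
  (* The quotient m / 8 is odd exactly when the valuation is 3. *)
  move=> m3; pose l := (logn 2 m - 3)%N; exists (n * 2 ^ l)%N.
  have mE2 : m = (8 * (n * 2 ^ l))%N.
    by rewrite {1}mE -(subnK m3) expnD mulnA mulnC.
  split=> //; first by rewrite oddM n_odd oddX orbF subn_eq0 [RHS]eqn_leq m3 andbT.
  move: mE2; set k := (n * _)%N => mE2.
  by apply: (squarefree_cofactor m_sqf (c := 16)); rewrite ?mE2; nia.
have v1 n' := @valuation1_case m K theta eps f sg dimK theta_gen span free
  theta_sqr eps_sqr sg_eps sg2_theta n'.
have v2 n' := @valuation2_case m K theta eps f sg dimK theta_gen span free
  theta_sqr eps_sqr sg_eps sg2_theta n'.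
have v3 n' := @valuation3_case m K theta eps f sg dimK theta_gen span free
  theta_sqr eps_sqr sg_eps sg2_theta n'.
split; first split.
- move=> m_odd; have [h hE] : exists h : int, m%:Z = 2 * h + 1 by exists m./2%:Z; lia.
  exact: (odd_common_index dimK theta_gen span free theta_sqr eps_sqr sg_eps sg2_theta hE
    (val0 m_odd)).
- move=> m_even; have : (0 < logn 2 m)%N.
    by rewrite lt0n; apply: contraNneq m_even => m0; rewrite mE m0 muln1.
  case m_val: (logn 2 m) => [|[|[|l]]] // _.
  + by have [n' [mE' odd_n' sqf]] := case1 m_val; have [] := v1 n' mE' odd_n' sqf.
  + by have [n' [mE' odd_n' sqf]] := case2 m_val; have [] := v2 n' mE' odd_n' sqf.
  + have [|n' [mE' _ sqf]] := case3; first by rewrite m_val.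
    by have [] := v3 n' mE' sqf.
- move=> m_odd; have [h hE] : exists h : int, m%:Z = 2 * h + 1 by exists m./2%:Z; lia.
  split=> [|s sE]; last first.
    exact: (odd_factorization dimK span free theta_sqr eps_sqr sg_eps sg2_theta hE
      (val0 m_odd) sE).
  exists (2 * eps - m%:R); rewrite natrD natrX.
  by ring: eps_sqr.
split.
- by move=> /case1[n' [mE' odd_n' sqf]]; have [] := v1 n' mE' odd_n' sqf.
- by move=> /case2[n' [mE' odd_n' sqf]]; have [] := v2 n' mE' odd_n' sqf.
- move=> m3; have [|n' [mE' odd_n' sqf]] := case3; first by rewrite m3.
  by have [_ + _] := v3 n' mE' sqf; apply; rewrite odd_n' m3.
- move=> m4; have [|n' [mE' odd_n' sqf]] := case3; first exact: ltnW.
  by have [_ _] := v3 n' mE' sqf; apply; rewrite odd_n' gtn_eqF.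
Qed.
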